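(* Let $\nu$ be a computable probability measure on Cantor space $2^{\mathbb{N}}$ with full support. Then, for every integer $\ell>1$, one has $\mathsf{MLR}^{\nu}= \mathsf{MR}^{\nu}_1(\ll_{kl}, \mathscr{F}_{n+\ell},D)$ and $\mathsf{SR}^{\nu}\supseteq \mathsf{MR}^{\nu}_1(\ll_{klc}, \mathscr{F}_{n+\ell},D)$.
   Context: A probability measure $\nu$ on Cantor space is identified with the function $\sigma\mapsto\nu(\sigma):=\nu([\sigma])$ on $2^{<\mathbb{N}}$, where $[\sigma]$ is the set of $\omega\in 2^{\mathbb{N}}$ extending $\sigma$. It is computable if the reals $\nu(\sigma)$ are computable uniformly in $\sigma$; it has full support if $\nu(\sigma)>0$ for all $\sigma$. $\omega\upharpoonright n$ is the length-$n$ initial segment of $\omega$. $\mathscr{F}_n$ is the $\sigma$-algebra generated by the sets $[\sigma]$ with $|\sigma|=n$. Kullback-Leibler divergence: for probability measures $P\ll Q$ on a $\sigma$-algebra $\mathscr{G}$, $D(P\mid Q)=\mathbb{E}_P[\ln \frac{dP}{dQ}]$. For $\nu,\mu$ with full support, $D_{\mathscr{F}_{n+\ell}}(\nu\mid\mu)(\omega)$ denotes $D(P\mid Q)$ where $P,Q$ are the restrictions to $\mathscr{F}_{n+\ell}$ of the conditional measures $\nu(\cdot\mid[\omega\upharpoonright n])$ and $\mu(\cdot\mid[\omega\upharpoonright n])$, respectively. For probability measures $\nu,\mu$ with full support: $\nu\ll_{kl}\mu$ iff $\sup_n \mathbb{E}_{\nu}\ln\frac{\nu(\cdot\upharpoonright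 n)}{\mu(\cdot\upharpoonright n)}$ (expectation of $\omega\mapsto \ln\frac{\nu(\omega\upharpoonright n)}{\mu(\omega\upharpoonright n)}$) is finite; $\nu\ll_{klc}\mu$ iff this supremum is finite and is a computable real. For a relation $\preceq$, $\mathsf{MR}^{\nu}_1(\preceq,\mathscr{F}_{n+\ell},D)$ is the set of $\omega\in 2^{\mathbb{N}}$ such that for all computable probability measures $\mu$ with full support and $\nu\preceq\mu$, one has $\sum_{n\ge 0} D_{\mathscr{F}_{n+\ell}}(\nu\mid\mu)(\omega)<\infty$. A c.e. open set is one of the form $\bigcup_n[\sigma_n]$ for a computable sequence $\sigma_n$ of binary strings. $\mathsf{MLR}^{\nu}$ (Martin-Löf $\nu$-random points) is the set of $\omega$ such that $\omega\notin\bigcap_n U_n$ for every computable sequence $U_n$ of c.e. opens with $\nu(U_n)\le 2^{-n}$ for all $n\ge 0$. $\mathsf{SR}^{\nu}$ (Schnorr $\nu$-random points) is defined in the same way but restricting to sequences for which in addition $\nu(U_n)$ is computable uniformly in $n$. *)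

(* Defs.v *)
From HB Require Import structures.
From mathcomp Require Import all_boot all_order all_algebra.
From mathcomp Require Import all_classical all_reals all_analysis.

Set Implicit Arguments.
Unset Strict Implicit.
Unset Printing Implicit Defensive.

Import Order.TTheory GRing.Theory Num.Theory.
Import numFieldNormedType.Exports.

Local Open Scope classical_set_scope.
Local Open Scope charge_scope.
Local Open Scope ring_scope.

(* The total (general) recursive functions: minimization is restricted to
   regular functions, i.e. [g] is total and [g v] is the least zero of
   [f (-, v)]. *)
Inductive recursive : forall k, (k.-tuple nat -> nat) -> Prop :=
| recursive_zero k : recursive (fun _ : k.-tuple nat => 0%N)
| recursive_succ : recursive (fun v : 1.-tuple nat => (thead v).+1)
| recursive_proj k (i : 'I_k) : recursive (fun v : k.-tuple nat => tnth v i)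
| recursive_comp k m (f : m.-tuple nat -> nat)
    (g : 'I_m -> k.-tuple nat -> nat) :
    recursive f -> (forall i, recursive (g i)) ->
    recursive (fun v => f [tuple g i v | i < m])
| recursive_primrec k (f : k.-tuple nat -> nat) (h : k.+2.-tuple nat -> nat) :
    recursive f -> recursive h ->
    recursive (fun v : k.+1.-tuple nat =>
      nat_rec (fun _ => nat) (f (behead_tuple v))
        (fun n r => h [tuple of n :: r :: behead_tuple v]) (thead v))
| recursive_min k (f : k.+1.-tuple nat -> nat) (g : k.-tuple nat -> nat) :
    recursive f ->
    (forall v, f [tuple of g v :: v] = 0%N) ->
    (forall v m, (m < g v)%N -> f [tuple of m :: v] <> 0%N) ->
    recursive g.

(* Bijective binary numeration, a bijection between binary strings and nat. *)
Definition str_code (s : seq bool) : nat :=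
  foldr (fun (b : bool) (c : nat) => (c.*2 + b).+1) 0%N s.

Definition computable_strings (s : nat -> nat -> seq bool) : Prop :=
  recursive (fun v : 2.-tuple nat => str_code (s (tnth v ord0) (tnth v ord_max))).

(* The reals [x i] are computable uniformly in [i], where [i] is presented by
   its code: some computable double sequence of rationals (a - b) / (c + 1)
   approximates [x i] within 2 ^ -n. *)
Definition computable_reals (R : realType) (I : Type) (code : I -> nat)
    (x : I -> R) : Prop :=
  exists a b c : 2.-tuple nat -> nat,
    [/\ recursive a, recursive b, recursive c &
      forall i n, let v := [tuple code i; n] in
        `|x i - ((a v)%:R - (b v)%:R) / (c v).+1%:R| <= 2 ^- n].

Definition computable_real (R : realType) (x : R) : Prop :=
  computable_reals (fun _ : unit => 0%N) (fun _ => x).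

Definition cantor : Type := g_sigma_algebraType (@open cantor_space).

HB.instance Definition _ := Measurable.on cantor.

Definition cyl (s : seq bool) : set cantor := [set w | mkseq w (size s) = s].

Definition cylinders (n : nat) : set (set cantor_space) :=
  [set cyl s | s in [set s | size s = n]].

Definition cantorF (n : nat) : Type := g_sigma_algebraType (cylinders n).

HB.instance Definition _ n := Measurable.on (cantorF n).
HB.instance Definition _ n := Pointed.on (cantorF n).

Lemma open_cyl (s : seq bool) : @open cantor_space (cyl s).
Proof.
have -> : cyl s = \bigcap_(i in [set i | i \in iota 0 (size s)])
    ((fun w : cantor_space => w i) @^-1` [set nth false s i]).
  apply/seteqP; split=> w.
  - move=> /(congr1 (fun t => nth false t _)) ws i /=.
    by rewrite mem_iota/= add0n => iS; rewrite -(ws i) nth_mkseq.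
  - move=> ws; rewrite /cyl/=; apply: (@eq_from_nth _ false).
      by rewrite size_mkseq.
    move=> i; rewrite size_mkseq => iS; rewrite nth_mkseq//.
    by apply: ws => /=; rewrite mem_iota.
rewrite bigcap_seq; elim: (iota 0 (size s)) => [|i t IH].
  by rewrite big_nil; exact: openT.
rewrite big_cons; apply: openI => //.
apply: open_comp; last exact: discrete_open.
by move=> w _; exact: proj_continuous.
Qed.

Lemma measurable_cyl (s : seq bool) : measurable (cyl s).
Proof. exact: sub_sigma_algebra (open_cyl s). Qed.

Definition toF (n : nat) : cantor -> cantorF n := id.

Lemma measurable_toF n : measurable_fun setT (@toF n).
Proof.
move=> _ A mA; rewrite setTI; apply: mA; split; last first.
  by move=> _ [s _ <-]; exact: measurable_cyl.
exact: (sigma_algebra_measurable cantor).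
Qed.

HB.instance Definition _ n :=
  isMeasurableFun.Build _ _ cantor (cantorF n) (@toF n) (@measurable_toF n).

Definition mass (R : realType) (nu : probability cantor R) (s : seq bool) : R :=
  fine (nu (cyl s)).

Definition computable_measure (R : realType) (nu : probability cantor R) :=
  computable_reals str_code (mass nu).

Definition full_support (R : realType) (nu : probability cantor R) : Prop :=
  forall s, 0 < mass nu s.

Definition KL d (T : measurableType d) (R : realType) (P Q : probability T R)
    : \bar R :=
  (\int[P]_x lne (('d (charge_of_finite_measure P) '/d Q) x))%E.

(* The conditional measure nu (- | [s]); the second argument of [mnormalize] is
   the default value used when nu [s] = 0, hence irrelevant for full support. *)
Definition conditional (R : realType) (nu : probability cantor R) (s : seq bool)
    : probability cantor R :=
  mnormalize (mrestr nu (measurable_cyl s)) nu.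

(* D_{F_m}(nu | mu)(w) for measures conditioned on [w|n]; the restriction of a
   measure to F_m is its image under the identity. *)
Definition KL_F (R : realType) (nu mu : probability cantor R) (n m : nat)
    (w : cantor) : \bar R :=
  KL (distribution (conditional nu (mkseq w n)) (@toF m))
     (distribution (conditional mu (mkseq w n)) (@toF m)).

Definition kl_sup (R : realType) (nu mu : probability cantor R) : \bar R :=
  ereal_sup (range (fun n : nat =>
    'E_nu[fun w => ln (mass nu (mkseq w n) / mass mu (mkseq w n))]%E)).

Definition ll_kl (R : realType) (nu mu : probability cantor R) : Prop :=
  kl_sup nu mu \is a fin_num.

Definition ll_klc (R : realType) (nu mu : probability cantor R) : Prop :=
  exists2 r : R, kl_sup nu mu = r%:E & computable_real r.

Definition MR1 (R : realType)
    (rel : probability cantor R -> probability cantor R -> Prop)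
    (nu : probability cantor R) (l : nat) : set cantor :=
  [set w | forall mu : probability cantor R,
    computable_measure mu -> full_support mu -> rel nu mu ->
    (\sum_(0 <= n <oo) KL_F nu mu n (n + l) w < +oo)%E].

Definition open_of (s : nat -> seq bool) : set cantor := \bigcup_m cyl (s m).

Definition ML_test (R : realType) (nu : probability cantor R)
    (s : nat -> nat -> seq bool) : Prop :=
  computable_strings s /\
  forall n, (nu (open_of (s n)) <= (2 ^- n)%:E)%E.

Definition Schnorr_test (R : realType) (nu : probability cantor R)
    (s : nat -> nat -> seq bool) : Prop :=
  ML_test nu s /\
  computable_reals id (fun n : nat => fine (nu (open_of (s n)))).

Definition MLR (R : realType) (nu : probability cantor R) : set cantor :=
  [set w | forall s, ML_test nu s -> ~ (\bigcap_n open_of (s n)) w].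

Definition SR (R : realType) (nu : probability cantor R) : set cantor :=
  [set w | forall s, Schnorr_test nu s -> ~ (\bigcap_n open_of (s n)) w].

(* Main.v *)
(* Along a point [w], the divergences D_(F_(n+l))(nu | mu)(w) are finite sums
   over binary strings. By the chain rule, their nu-integrals telescope, so the
   integral of their sum is at most [l] times the supremum defining
   nu <<_kl mu. Being lower semicomputable, this sum is finite at every
   Martin-Löf random point, by Markov's inequality.

   Conversely, let a test catch [w]. The open sets of the test are replaced by
   decidable sets of strings, so that entering one of them is a decidable event;
   at each entry [t], the conditional probability that nu gives to a fixed bit
   [i] is divided by four. The resulting measure mu_i is computable, and the
   one-step divergence at [t] is bounded, hence the total divergence is at most a
   constant times the sum of the measures of the open sets, with a computable
   tail when the test is a Schnorr test. This one-step divergence is also at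
   least nu(i | t) / 4. As nu(0 | t) + nu(1 | t) = 1 and [w] has infinitely many
   entries, the sum along [w] diverges for mu_0 or for mu_1. *)

Require Import Defs.
From HB Require Import structures.
From mathcomp Require Import all_boot all_order all_algebra.
From mathcomp Require Import all_classical all_reals all_analysis.
From mathcomp Require Import ring lra zify.

Set Implicit Arguments.
Unset Strict Implicit.
Unset Printing Implicit Defensive.

Import Order.TTheory GRing.Theory Num.Theory.
Import numFieldNormedType.Exports.

(** * Recursive functions and computable functions *)

(** Two obstacles shape the converse direction. First, [nu] gives no positive lower bound for the
    conditional probability of a fixed bit, and which of two bits is the likelier one cannot be
    decided, so no single computable choice of bit is sure to cost enough at every entry. Tilting
    each bit separately makes the two lower bounds add up to 1/4 at each entry. The factor four
    serves to make ln 4 >= 1 exceed what the other bit gains back, at most 3/4 of nu(i | t). Second,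
    inclusion of a cylinder in an open set of the test is in general only enumerable, while the
    masses of mu_i must be computed; hence the decidable approximations. Their length requirement
    leaves finitely many sets to examine at each string, and puts the entry into the n-th set beyond
    length n, so that a caught point has infinitely many entries. Computable reals are handled
    through their two cuts, each enumerable. This suits the supremum of the Schnorr case: its lower
    cut is enumerated by the increasing levels, its upper cut by a level plus a bound on what
    remains, which involves the measures of the open sets. *)

Lemma recursive_ext k (f g : k.-tuple nat -> nat) :
  f =1 g -> recursive f -> recursive g.
Proof. by move=> /funext ->. Qed.

Lemma recursive_comp1 k (f : 1.-tuple nat -> nat) (g : k.-tuple nat -> nat) :
  recursive f -> recursive g -> recursive (fun v => f [tuple g v]).
Proof.
move=> rf rg; apply: recursive_ext (recursive_comp rf (fun=> rg)) => v.
by congr f; apply: eq_from_tnth => i; rewrite tnth_mktuple (ord1 i).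
Qed.

Lemma recursive_comp2 k (f : 2.-tuple nat -> nat) (g h : k.-tuple nat -> nat) :
  recursive f -> recursive g -> recursive h ->
  recursive (fun v => f [tuple g v; h v]).
Proof.
move=> rf rg rh.
have rgh (i : 'I_2) : recursive (if i == ord0 then g else h) by case: ifP.
apply: recursive_ext (recursive_comp rf rgh) => v.
congr f; apply: eq_from_tnth => -[[|[|//]] i2];
  by rewrite tnth_mktuple (tnth_nth 0).
Qed.

Lemma recursive_succ_comp k (f : k.-tuple nat -> nat) :
  recursive f -> recursive (fun v => (f v).+1).
Proof. exact: recursive_comp1 recursive_succ. Qed.

Lemma recursive_const k c : recursive (fun _ : k.-tuple nat => c).
Proof.
elim: c => [|c IH]; [exact: recursive_zero|exact: recursive_succ_comp].
Qed.

(** A two-argument form of [recursive_primrec], with the parameter first and the recursion variable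
    second; [g] receives the stage, the previous value and the parameter, in the order imposed by
    that constructor. *)
Lemma recursive_rec k (F : nat -> nat -> nat)
    (f h : k.-tuple nat -> nat) (g : 3.-tuple nat -> nat) :
  (forall a n, F a n.+1 = g [tuple n; F a n; a]) ->
  recursive (fun v : 1.-tuple nat => F (thead v) 0) -> recursive g ->
  recursive f -> recursive h -> recursive (fun v => F (f v) (h v)).
Proof.
move=> FS F0 rg rf rh.
apply: recursive_ext (recursive_comp2 (recursive_primrec F0 rg) rh rf) => v.
have -> : behead_tuple [tuple h v; f v] = [tuple f v] by exact: val_inj.
rewrite (_ : thead [tuple h v; f v] = h v) //.
elim: (h v) => [|n IH] //=.
by rewrite FS -IH; congr g; apply: val_inj.
Qed.

Lemma recursive_add k (f h : k.-tuple nat -> nat) :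
  recursive f -> recursive h -> recursive (fun v => f v + h v).
Proof.
apply: (@recursive_rec _ addn _ _ (fun v => (tnth v (inord 1)).+1)).
- by move=> a n; rewrite (tnth_nth 0) inordK //= addnS.
- by apply: recursive_ext (recursive_proj ord0) => v /=; rewrite addn0.
- exact/recursive_succ_comp/recursive_proj.
Qed.

Lemma recursive_mul k (f h : k.-tuple nat -> nat) :
  recursive f -> recursive h -> recursive (fun v => f v * h v).
Proof.
apply: (@recursive_rec _ muln _ _ (fun v => tnth v (inord 2) + tnth v (inord 1))).
- by move=> a n; rewrite !(tnth_nth 0) !inordK //= mulnS.
- by apply: recursive_ext (recursive_const _ 0) => v /=; rewrite muln0.
- by apply: recursive_add; exact: recursive_proj.
Qed.

Lemma recursive_pred k (f : k.-tuple nat -> nat) :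
  recursive f -> recursive (fun v => (f v).-1).
Proof.
move=> rf.
apply: (@recursive_rec _ (fun _ n => n.-1) f f (fun v => tnth v ord0)) => //.
  exact: recursive_const.
exact: recursive_proj.
Qed.

Lemma recursive_sub k (f h : k.-tuple nat -> nat) :
  recursive f -> recursive h -> recursive (fun v => f v - h v).
Proof.
apply: (@recursive_rec _ subn _ _ (fun v => (tnth v (inord 1)).-1)).
- by move=> a n; rewrite (tnth_nth 0) inordK //= subnS.
- by apply: recursive_ext (recursive_proj ord0) => v /=; rewrite subn0.
- exact/recursive_pred/recursive_proj.
Qed.

Fixpoint triangle n := if n is m.+1 then triangle m + n else 0.

Lemma recursive_triangle k (f : k.-tuple nat -> nat) :
  recursive f -> recursive (fun v => triangle (f v)).
Proof.
move=> rf.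
apply: (@recursive_rec _ (fun _ n => triangle n) f f
  (fun v => tnth v (inord 1) + (tnth v ord0).+1)) => //.
- by move=> a n; rewrite !(tnth_nth 0) inordK.
- exact: recursive_const.
- by apply: recursive_add; [|apply: recursive_succ_comp]; exact: recursive_proj.
Qed.

Lemma triangle_mono : {homo triangle : m n / m <= n}.
Proof.
move=> m n /subnK <-; elim: (n - m) => [//|k IH].
by rewrite addSn /= (leq_trans IH) // leq_addr.
Qed.

Lemma leq_triangle n : n <= triangle n.
Proof. by case: n => [//|n]; exact: leq_addl. Qed.

(* Cantor's pairing function: [diag z] is the index of the antidiagonal
   containing the pair coded by [z]. *)
Definition pair_code (a b : nat) : nat := triangle (a + b) + b.

(** The truncated difference vanishes exactly when [z] is below [triangle s.+1]. Written as an
    equation to zero, the search for [s] has the shape required by [recursive_min]. *)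
Fact diag_ex z : exists s, z.+1 - triangle s.+1 == 0.
Proof. by exists z; rewrite subn_eq0 leq_triangle. Qed.

Definition diag z := ex_minn (diag_ex z).
Definition unpair2 z := z - triangle (diag z).
Definition unpair1 z := diag z - unpair2 z.

Lemma diag_pair a b : diag (pair_code a b) = a + b.
Proof.
rewrite /diag; case: ex_minnP => s; rewrite subn_eq0 /pair_code => zs smin.
apply/eqP; rewrite eqn_leq smin ?andbT; last first.
  by rewrite subn_eq0 /= -addnS leq_add2l ltnS leq_addl.
rewrite leqNgt; apply/negP => sab.
move: (leq_trans zs (triangle_mono sab)).
by rewrite ltnNge leq_addr.
Qed.

Lemma pair_codeK2 a b : unpair2 (pair_code a b) = b.
Proof. by rewrite /unpair2 diag_pair addKn. Qed.

Lemma pair_codeK1 a b : unpair1 (pair_code a b) = a.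
Proof. by rewrite /unpair1 pair_codeK2 diag_pair addnK. Qed.

Definition rec1 (f : nat -> nat) : Prop :=
  recursive (fun v : 1.-tuple nat => f (thead v)).

Lemma rec1_recursive k f (g : k.-tuple nat -> nat) :
  rec1 f -> recursive g -> recursive (fun v => f (g v)).
Proof.
by move=> rf rg; apply: recursive_ext (recursive_comp1 rf rg) => v; rewrite theadE.
Qed.

Lemma rec1_pair_code f g : rec1 f -> rec1 g ->
  rec1 (fun n => pair_code (f n) (g n)).
Proof.
by move=> rf rg; do ?[exact: rf|exact: rg|apply: recursive_add|
  apply: recursive_triangle].
Qed.

Lemma tnth_cons_max x (v : 1.-tuple nat) : tnth [tuple of x :: v] ord_max = thead v.
Proof. by rewrite /thead !(tnth_nth 0). Qed.

Lemma rec1_diag : rec1 diag.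
Proof.
pose f (v : 2.-tuple nat) := (tnth v ord_max).+1 - triangle (tnth v ord0).+1.
apply: (@recursive_min _ f).
- by apply: recursive_sub; [|apply: recursive_triangle];
    apply: recursive_succ_comp; exact: recursive_proj.
- move=> v; rewrite /f tnth_cons_max /diag.
  by case: ex_minnP => s /eqP.
- move=> v m; rewrite /f tnth_cons_max /diag.
  case: ex_minnP => s _ smin ms /eqP /smin; rewrite leqNgt.
  by rewrite [tnth _ _](tnth_nth 0) /= ms.
Qed.

Lemma rec1_unpair2 : rec1 unpair2.
Proof.
have rd := rec1_diag; apply: recursive_sub; first exact: recursive_proj.
exact: recursive_triangle.
Qed.

Lemma rec1_unpair1 : rec1 unpair1.
Proof. exact: recursive_sub rec1_diag rec1_unpair2. Qed.

Lemma rec1_comp f g : rec1 f -> rec1 g -> rec1 (fun n => f (g n)).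
Proof. exact: rec1_recursive. Qed.

(* [dec] is total, but numbers that are not codes may be decoded arbitrarily, as
   long as the code of the result is computable. *)
Structure codeType := CodeType {
  code_sort :> Type; enc : code_sort -> nat; dec : nat -> code_sort;
  encK : cancel enc dec; enc_dec_rec : rec1 (fun n => enc (dec n)) }.
Arguments enc {c} : simpl never.
Arguments dec {c} : simpl never.
Arguments encK {c}.

(** The function [g] on codes is total, but unconstrained at numbers that are not codes. *)
Definition computable (A B : codeType) (f : A -> B) : Prop :=
  exists2 g, rec1 g & forall a, g (enc a) = enc (f a).

Canonical nat_codeType :=
  @CodeType nat id id (fun=> erefl) (recursive_proj ord0).

Lemma rec1_const c : rec1 (fun=> c).
Proof. exact: recursive_const. Qed.

Fact bool_dec_rec : rec1 (fun n => nat_of_bool (0 < n)).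
Proof.
apply: recursive_ext (recursive_sub (recursive_const _ 1)
  (recursive_sub (recursive_const _ 1) (recursive_proj ord0))) => v.
by rewrite /thead; case: (tnth v ord0).
Qed.

Fact nat_of_boolK : cancel nat_of_bool (fun n => 0 < n).
Proof. by case. Qed.

Canonical bool_codeType := CodeType nat_of_boolK bool_dec_rec.

Section Pair.
Context (A B : codeType).

Definition enc_pair (p : A * B) := pair_code (enc p.1) (enc p.2).
Definition dec_pair n : A * B := (dec (unpair1 n), dec (unpair2 n)).

Fact enc_pairK : cancel enc_pair dec_pair.
Proof. by case=> a b; rewrite /dec_pair pair_codeK1 pair_codeK2 ?encK. Qed.

Fact enc_dec_pair_rec : rec1 (fun n => enc_pair (dec_pair n)).
Proof.
apply: rec1_pair_code.
  exact: rec1_comp (@enc_dec_rec A) rec1_unpair1.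
exact: rec1_comp (@enc_dec_rec B) rec1_unpair2.
Qed.

Canonical pair_codeType := CodeType enc_pairK enc_dec_pair_rec.

End Pair.

Section Closure.
Context (A B C D : codeType).

Lemma enc_inj : injective (@enc A).
Proof. exact: can_inj encK. Qed.

Lemma computable_id : computable (fun a : A => a).
Proof. by exists id => //; exact: recursive_proj. Qed.

Lemma computable_const (b : B) : computable (fun _ : A => b).
Proof. by exists (fun=> enc b) => //; exact: rec1_const. Qed.

Lemma computable_comp (f : B -> C) (g : A -> B) :
  computable f -> computable g -> computable (fun a => f (g a)).
Proof.
move=> [f' rf fE] [g' rg gE]; exists (fun n => f' (g' n)); first exact: rec1_comp.
by move=> a; rewrite gE fE.
Qed.

Lemma computable_pair (f : A -> B) (g : A -> C) :
  computable f -> computable g -> computable (fun a => (f a, g a)).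
Proof.
move=> [f' rf fE] [g' rg gE]; exists (fun n => pair_code (f' n) (g' n)).
  exact: rec1_pair_code.
by move=> a; rewrite gE fE.
Qed.

Lemma computable_fst (f : A -> B * C) : computable f ->
  computable (fun a => (f a).1).
Proof.
move=> [f' rf fE]; exists (fun n => unpair1 (f' n)).
  exact: rec1_comp rec1_unpair1 rf.
by move=> a; rewrite fE pair_codeK1.
Qed.

Lemma computable_snd (f : A -> B * C) : computable f ->
  computable (fun a => (f a).2).
Proof.
move=> [f' rf fE]; exists (fun n => unpair2 (f' n)).
  exact: rec1_comp rec1_unpair2 rf.
by move=> a; rewrite fE pair_codeK2.
Qed.

Lemma computable_enc (f : A -> B) : computable f -> computable (fun a => enc (f a)).
Proof. by move=> [g rg gE]; exists g. Qed.

Lemma computable_dec (f : A -> nat) : computable f ->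
  computable (fun a => dec (f a) : B).
Proof.
move=> [g rg gE]; exists (fun n => enc (dec (g n) : B)).
  exact: rec1_comp (@enc_dec_rec B) rg.
by move=> a; rewrite gE.
Qed.

End Closure.
Arguments computable_id {A}.
Arguments computable_const {A B} b.

Lemma computable_ext (A B : codeType) (f g : A -> B) :
  f =1 g -> computable f -> computable g.
Proof. by move=> /funext ->. Qed.

Lemma computable_comp2 (A B C D : codeType) (f : B -> C -> D) (g : A ->
  B) (h : A -> C) :
  computable (fun p : B * C => f p.1 p.2) -> computable g -> computable h ->
  computable (fun a => f (g a) (h a)).
Proof.
move=> cf cg ch; exact: (computable_comp cf (computable_pair cg ch)).
Qed.

(** * Arithmetic, case distinction, recursion and search on coded types *)

Section Arith.
Context (A : codeType).
Implicit Types f g : A -> nat.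

Lemma computable_succ f : computable f -> computable (fun a => (f a).+1).
Proof.
move=> [f' rf fE]; exists (fun n => (f' n).+1); first exact: recursive_succ_comp rf.
by move=> a; rewrite fE.
Qed.

Lemma computable_add f g : computable f -> computable g ->
  computable (fun a => f a + g a).
Proof.
move=> [f' rf fE] [g' rg gE]; exists (fun n => f' n + g' n).
  exact: recursive_add rf rg.
by move=> a; rewrite fE gE.
Qed.

Lemma computable_mul f g : computable f -> computable g ->
  computable (fun a => f a * g a).
Proof.
move=> [f' rf fE] [g' rg gE]; exists (fun n => f' n * g' n).
  exact: recursive_mul rf rg.
by move=> a; rewrite fE gE.
Qed.

Lemma computable_sub f g : computable f -> computable g ->
  computable (fun a => f a - g a).
Proof.
move=> [f' rf fE] [g' rg gE]; exists (fun n => f' n - g' n).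
  exact: recursive_sub rf rg.
by move=> a; rewrite fE gE.
Qed.

Lemma computable_gt0 f : computable f -> computable (fun a => 0 < f a).
Proof. exact: (computable_dec bool_codeType). Qed.

Lemma computable_b2n (p : A -> bool) : computable p ->
  computable (fun a => nat_of_bool (p a)).
Proof. exact: computable_enc. Qed.

Lemma computable_not (p : A -> bool) : computable p -> computable (fun a => ~~ p a).
Proof.
move=> cp; apply: computable_ext (computable_gt0 (computable_sub
  (computable_const 1) (computable_b2n cp))) => a.
by case: (p a).
Qed.

Lemma computable_and (p q : A -> bool) : computable p -> computable q ->
  computable (fun a => p a && q a).
Proof.
move=> cp cq; apply: computable_ext (computable_gt0 (computable_mul
  (computable_b2n cp) (computable_b2n cq))) => a.
by case: (p a) => //; case: (q a).
Qed.

Lemma computable_or (p q : A -> bool) : computable p -> computable q ->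
  computable (fun a => p a || q a).
Proof.
move=> cp cq; apply: computable_ext (computable_gt0 (computable_add
  (computable_b2n cp) (computable_b2n cq))) => a.
by case: (p a) => //; case: (q a).
Qed.

Lemma computable_leq f g : computable f -> computable g ->
  computable (fun a => f a <= g a).
Proof.
move=> cf cg; apply: computable_ext (computable_not (computable_gt0
  (computable_sub cf cg))) => a.
by rewrite lt0n negbK.
Qed.

Lemma computable_eq_enc (B : codeType) (f g : A -> B) :
  computable f -> computable g -> computable (fun a => enc (f a) == enc (g a)).
Proof.
move=> cf cg; have cf' := computable_enc cf; have cg' := computable_enc cg.
by apply: computable_ext (computable_and (computable_leq cf' cg')
  (computable_leq cg' cf')) => a; rewrite -eqn_leq.
Qed.

(** The codes of the two branches are multiplied by the truth values of [p] and its negation, added,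
    and decoded. *)
Lemma computable_if (B : codeType) (p : A -> bool) (f g : A -> B) :
  computable p -> computable f -> computable g ->
    computable (fun a => if p a then f a else g a).
Proof.
move=> cp cf cg.
apply: computable_ext (computable_dec B (computable_add
  (computable_mul (computable_b2n cp) (computable_enc cf))
  (computable_mul (computable_b2n (computable_not cp)) (computable_enc cg)))) => a.
by case: (p a); rewrite /= mul1n mul0n ?addn0 ?add0n encK.
Qed.

Lemma computable_rec (B : codeType) (F : A -> nat -> B) (g : A -> B)
    (h : A * (nat * B) -> B) (k : A -> nat) :
  (forall a, F a 0 = g a) -> (forall a n, F a n.+1 = h (a, (n, F a n))) ->
  computable g -> computable h -> computable k -> computable (fun a => F a (k a)).
Proof.
move=> F0 FS [g' rg gE] [h' rh hE] [k' rk kE].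
pose F' a := nat_rec (fun=> nat) (g' a) (fun n r =>
  h' (pair_code a (pair_code n r))).
exists (fun n => F' n (k' n)).
  apply: (@recursive_rec _ F' _ _ (fun v => h' (pair_code (tnth v (inord 2))
    (pair_code (tnth v (inord 0)) (tnth v (inord 1)))))) => //.
  - by move=> a n; rewrite !(tnth_nth 0) !inordK.
  - have rp i : recursive (fun v : 3.-tuple nat =>
    tnth v i) by exact: recursive_proj.
    apply: (rec1_recursive rh).
    by do ?[exact: rp|apply: recursive_add|apply: recursive_triangle].
  - exact: recursive_proj.
move=> a; rewrite kE /= /F'; elim: (k a) => [|n IH] /=; first by rewrite gE F0.
by rewrite IH FS -hE.
Qed.

Lemma computable_search (p : A * nat -> bool) (f : A -> nat) :
  computable p -> (forall a, p (a, f a)) -> (forall a m, m < f a -> ~~ p (a, m)) ->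
  computable f.
Proof.
move=> [p' rp pE] pf fmin.
(* Minimization requires a zero for every [n], even one that is not a code; passing through
   [enc (dec n)] reduces to genuine codes, where [p] guarantees one. *)
pose q (n m : nat) := 1 - p' (pair_code (@enc A (@dec A n)) m).
have qE a m : q (@enc A a) m = ~~ p (a, m).
  by rewrite /q (@encK A) (pE (a, m)) /=; case: (p _).
have ex n : exists m, q n m == 0.
  exists (f (dec n)).
  have := qE (dec n) (f (dec n)); rewrite /q (@encK A) => ->.
  by rewrite pf.
exists (fun n => ex_minn (ex n)).
  apply: (@recursive_min _ (fun v => q (tnth v ord_max) (tnth v ord0))).
  - apply: recursive_sub; first exact: recursive_const.
    apply: (rec1_recursive rp).
    have rp1 i : recursive (fun v : 2.-tuple nat =>
      tnth v i) by exact: recursive_proj.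
    have re := rec1_recursive (@enc_dec_rec A) (rp1 ord_max).
    by do ?[exact: rp1|exact: re|apply: recursive_add|apply: recursive_triangle].
  - move=> v; rewrite tnth_cons_max.
    by case: ex_minnP => s /eqP.
  - move=> v m; rewrite tnth_cons_max.
    case: ex_minnP => s _ smin ms /eqP /smin; rewrite leqNgt.
    by rewrite [tnth _ _](tnth_nth 0) /= ms.
move=> a; case: ex_minnP => s; rewrite qE eqb0 negbK => ps smin.
apply/eqP; rewrite eqn_leq smin ?qE ?pf // leqNgt.
by apply/negP => /fmin; rewrite ps.
Qed.

End Arith.

Lemma recursive2_computable (A : codeType) (a : 2.-tuple nat ->
  nat) (f g : A -> nat) :
  recursive a -> computable f -> computable g ->
    computable (fun x => a [tuple f x; g x]).
Proof.
move=> ra [f' rf fE] [g' rg gE].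
exists (fun n => a [tuple f' n; g' n]); first exact: recursive_comp2 ra rf rg.
by move=> x; rewrite fE gE.
Qed.

Lemma computable_recursive2 (f : nat * nat -> nat) : computable f ->
  recursive (fun v : 2.-tuple nat => f (tnth v ord0, tnth v ord_max)).
Proof.
move=> [f' rf fE].
have rp i : recursive (fun v : 2.-tuple nat => tnth v i) by exact: recursive_proj.
pose g (v : 2.-tuple nat) := pair_code (tnth v ord0) (tnth v ord_max).
have rg : recursive g.
  by do ?[exact: rp|apply: recursive_add|apply: recursive_triangle].
by apply: recursive_ext (rec1_recursive rf rg) => v; exact: (fE (_, _)).
Qed.

Section MoreArith.
Context (A : codeType).
Implicit Types f g : A -> nat.

Lemma computable_half f : computable f -> computable (fun a => (f a)./2).
Proof.
move=> cf; apply: (@computable_rec _ nat_codeType (fun _ n => n./2) (fun=> 0)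
  (fun x => x.2.1 - x.2.2)) => //.
(* The recursion for halving uses no parity test, so that parity can afterwards be computed from
   it. *)
- move=> a n; change (uphalf n = n - n./2).
  by rewrite uphalf_half -[X in X - _]odd_double_half -addnn addnA addnK.
- exact: computable_const.
- by apply: computable_sub; [apply: computable_fst|apply: computable_snd];
  exact: computable_snd computable_id.
Qed.

Lemma computable_odd f : computable f -> computable (fun a => odd (f a)).
Proof.
move=> cf; have ch := computable_half cf.
apply: computable_ext (computable_gt0 (computable_sub cf
  (computable_add ch ch))) => a.
by rewrite addnn -{1}(odd_double_half (f a)) addnK lt0b.
Qed.

Lemma computable_expn f g : computable f -> computable g ->
  computable (fun a => f a ^ g a).
Proof.
move=> cf cg; apply: (@computable_rec _ nat_codeType (fun a n => f a ^ n) (fun=> 1)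
  (fun x => f x.1 * x.2.2)) => //.
- by move=> a n; rewrite expnS.
- exact: computable_const.
- apply: computable_mul; first exact: computable_comp cf
  (computable_fst computable_id).
  exact: computable_snd (computable_snd computable_id).
Qed.

Lemma computable_pred f : computable f -> computable (fun a => (f a).-1).
Proof.
move=> cf; apply: computable_ext (computable_sub cf (computable_const 1)) => a.
by rewrite subn1.
Qed.

Lemma computable_has (p : A * nat -> bool) f : computable p -> computable f ->
  computable (fun a => has (fun m => p (a, m)) (iota 0 (f a))).
Proof.
move=> cp cf; apply: (@computable_rec _ bool_codeType
  (fun a n => has (fun m => p (a, m)) (iota 0 n)) (fun=> false)
  (fun x => x.2.2 || p (x.1, x.2.1))) => //.
- by move=> a n; rewrite -addn1 iotaD has_cat /= orbF.
- exact: computable_const.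
- apply: computable_or; first exact: computable_snd (computable_snd computable_id).
  apply: (computable_comp cp); apply: computable_pair;
    first exact: computable_fst computable_id.
  exact: computable_fst (computable_snd computable_id).
Qed.

Lemma computable_of_enc (B : codeType) (f : A ->
  B) : computable (fun a => enc (f a)) -> computable f.
Proof. by case=> g rg gE; exists g. Qed.

End MoreArith.

(** * Operations on binary strings, computed on their codes *)

Fixpoint str_decode_rec (k n : nat) : seq bool :=
  if k is k'.+1 then
    if n is m.+1 then odd m :: str_decode_rec k' m./2 else [::]
  else [::].

Definition str_decode (n : nat) : seq bool := str_decode_rec n n.

Lemma str_decode_recK k n : n <= k -> str_code (str_decode_rec k n) = n.
Proof.
elim: k n => [|k IH] [|n] //=; rewrite ltnS => nk.
rewrite IH; last by rewrite leq_half_double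
  (leq_trans nk) // leqW // -addnn leq_addr.
by rewrite addnC odd_double_half.
Qed.

Lemma str_decodeK : cancel str_decode str_code.
Proof. by move=> n; exact: str_decode_recK. Qed.

Lemma str_code_inj : injective str_code.
Proof.
elim=> [|b s IH] [|c t] //= [] /[dup] /(congr1 odd).
by rewrite !oddD !odd_double !oddb /= => -> /addIn /double_inj /IH ->.
Qed.

Lemma str_codeK : cancel str_code str_decode.
Proof. by move=> s; apply: str_code_inj; rewrite str_decodeK. Qed.

Fact str_enc_dec_rec : rec1 (fun n => str_code (str_decode n)).
Proof.
apply: recursive_ext (recursive_proj ord0) => v.
by rewrite str_decodeK.
Qed.

Canonical str_codeType := CodeType str_codeK str_enc_dec_rec.

(** The first bit is the least significant digit, so the second string is shifted by [size s]
    places. Concatenation and [take] are computed on codes from this identity. *)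
Lemma str_code_cat s t : str_code (s ++ t) = str_code s + 2 ^ size s * str_code t.
Proof.
elim: s => [|b s IH] /=; first by rewrite mul1n.
by rewrite IH expnS -mulnA mul2n doubleD addSn addnAC.
Qed.

Lemma str_code_behead s : str_code (behead s) = (str_code s).-1./2.
Proof. by case: s => //= b s; rewrite addnC half_bit_double. Qed.

Section Strings.
Context (A : codeType).
Implicit Types (s t : A -> seq bool) (k : A -> nat).

Lemma computable_str_code s : computable s -> computable (fun a => str_code (s a)).
Proof. exact: computable_enc. Qed.

Lemma computable_str_decode k : computable k ->
  computable (fun a => str_decode (k a)).
Proof. exact: (computable_dec str_codeType). Qed.

Lemma computable_eq_str s t : computable s -> computable t ->
  computable (fun a => s a == t a).
Proof.
move=> cs ct; apply: computable_ext (computable_eq_enc cs ct) => a.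
exact: inj_eq str_code_inj _ _.
Qed.

Lemma computable_eq_bool (f g : A -> bool) : computable f -> computable g ->
  computable (fun a => f a == g a).
Proof.
move=> cs ct; apply: computable_ext (computable_eq_enc cs ct) => a.
exact: inj_eq (@enc_inj bool_codeType) _ _.
Qed.

Lemma computable_behead s : computable s -> computable (fun a => behead (s a)).
Proof.
move=> cs; apply: computable_of_enc.
apply: computable_ext (computable_half (computable_pred
  (computable_str_code cs))) => a.
by rewrite -str_code_behead.
Qed.

End Strings.

Section Strings.
Context (A : codeType).
Implicit Types (s t : A -> seq bool) (k : A -> nat).

Lemma computable_drop k s : computable k -> computable s ->
  computable (fun a => drop (k a) (s a)).
Proof.
move=> ck cs; apply: (@computable_rec _ str_codeType (fun a n => drop n (s a)) s
  (fun x => behead x.2.2)) => //.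
- by move=> a; rewrite drop0.
- by move=> a n; rewrite -addn1 addnC -drop_drop drop1.
- exact: computable_behead (computable_snd (computable_snd computable_id)).
Qed.

End Strings.

Section Strings.
Context (A : codeType).
Implicit Types (s t : A -> seq bool) (k : A -> nat).

Lemma computable_take k s : computable k -> computable s ->
  computable (fun a => take (k a) (s a)).
Proof.
move=> ck cs; apply: computable_of_enc.
apply: computable_ext (computable_sub (computable_str_code cs) (computable_mul
  (computable_expn (computable_const 2) ck) (computable_str_code
    (computable_drop ck cs)))) => a.
(* If [k a] exceeds the size, the dropped part is empty and has code 0, so nothing is subtracted. *)
have /orP[ks|ks] := leq_total (k a) (size (s a)).
  rewrite -{1}(cat_take_drop (k a) (s a)) str_code_cat size_take_min.
  by move/minn_idPl: ks => ->; rewrite addnK.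
by rewrite drop_oversize //= muln0 subn0 take_oversize.
Qed.

(** The size is the least number of bits whose removal leaves the empty string. *)
Lemma computable_size s : computable s -> computable (fun a => size (s a)).
Proof.
move=> cs.
apply: (@computable_search _ (fun x => drop x.2 (s x.1) == [::])).
- apply: computable_eq_str; last exact: computable_const.
  exact: computable_drop (computable_snd computable_id) (computable_comp cs
    (computable_fst computable_id)).
- by move=> a /=; rewrite drop_size.
- by move=> a m /= ms; rewrite -size_eq0 size_drop subn_eq0 -ltnNge.
Qed.

Lemma computable_cat s t : computable s -> computable t ->
  computable (fun a => s a ++ t a).
Proof.
move=> cs ct; apply: computable_of_enc.
apply: computable_ext (computable_add (computable_str_code cs) (computable_mul
  (computable_expn (computable_const 2) (computable_size cs))
    (computable_str_code ct))) => a.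
by rewrite -str_code_cat.
Qed.

Lemma computable_nth s k : computable s -> computable k ->
  computable (fun a => nth false (s a) (k a)).
Proof.
move=> cs ck.
apply: computable_ext (computable_odd (computable_pred (computable_str_code
  (computable_drop ck cs)))) => a.
rewrite -[in RHS](addn0 (k a)) -nth_drop; case: (drop _ _) => [|b t] //=.
by rewrite oddD odd_double oddb.
Qed.

Lemma computable_prefix s t : computable s -> computable t ->
  computable (fun a => prefix (s a) (t a)).
Proof.
move=> cs ct; apply: computable_ext (computable_eq_str (computable_take
  (computable_size cs) ct) cs) => a.
by rewrite prefixE.
Qed.

End Strings.

(** * Computably enumerable predicates *)

Definition dec1 (A B : codeType) (n : nat) : A := (dec n : A * B).1.
Definition dec2 (A B : codeType) (n : nat) : B := (dec n : A * B).2.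
Arguments dec1 : simpl never.
Arguments dec2 : simpl never.

Lemma dec1K (A B : codeType) (a : A) (b : B) : dec1 A B (enc (a, b)) = a.
Proof. by rewrite /dec1 encK. Qed.

Lemma dec2K (A B : codeType) (a : A) (b : B) : dec2 A B (enc (a, b)) = b.
Proof. by rewrite /dec2 encK. Qed.

Definition sigma1 (A : codeType) (P : A -> Prop) : Prop :=
  exists2 p : A * nat -> bool, computable p & forall a, P a <-> exists n, p (a, n).

Section Sigma1.
Context (A B : codeType).
Implicit Types P Q : A -> Prop.

Lemma sigma1_ext P Q : (forall a, P a <-> Q a) -> sigma1 P -> sigma1 Q.
Proof. by move=> PQ [p cp pE]; exists p => // a; rewrite -PQ. Qed.

Lemma sigma1_comp (P : B -> Prop) (f : A -> B) :
  sigma1 P -> computable f -> sigma1 (fun a => P (f a)).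
Proof.
move=> [p cp pE] cf; exists (fun x => p (f x.1, x.2)) => [|a]; last exact: pE.
apply: (computable_comp cp); apply: computable_pair (computable_snd computable_id).
exact: computable_comp cf (computable_fst computable_id).
Qed.

Lemma sigma1_dec (p : A -> bool) : computable p -> sigma1 (fun a => p a).
Proof.
move=> cp; exists (fun x => p x.1);
  first exact: computable_comp cp (computable_fst computable_id).
by move=> a; split=> [pa|[]//]; exists 0.
Qed.

Lemma sigma1_ex (P : A * B -> Prop) :
  sigma1 P -> sigma1 (fun a => exists b, P (a, b)).
Proof.
move=> [p cp pE].
exists (fun x => p ((x.1, dec1 B nat_codeType x.2), dec2 B nat_codeType x.2)).
  have cd : computable (fun x : A * nat => dec x.2 : B * nat).
    exact: computable_dec (computable_snd computable_id).
  apply: (computable_comp cp); apply: computable_pair (computable_snd cd).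
  exact: computable_pair (computable_fst computable_id) (computable_fst cd).
move=> a; split=> [[b /pE[n pn]]|[n pn]].
  by exists (enc (b, n)); rewrite /= dec1K dec2K.
by exists (dec1 B nat_codeType n); apply/pE; exists (dec2 B nat_codeType n).
Qed.

Lemma sigma1_and P Q : sigma1 P -> sigma1 Q -> sigma1 (fun a => P a /\ Q a).
Proof.
move=> [p cp pE] [q cq qE].
exists (fun x => p (x.1, dec1 nat_codeType nat_codeType x.2) && q
  (x.1, dec2 nat_codeType nat_codeType x.2)).
  have cd : computable (fun x : A * nat => dec x.2 : nat * nat).
    exact: computable_dec (computable_snd computable_id).
  by apply: computable_and; [apply: (computable_comp cp)|apply:
    (computable_comp cq)];
    apply: (computable_pair (computable_fst computable_id));
      [apply: computable_fst|apply: computable_snd].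
move=> a; split=> [[/pE[m pm] /qE[n qn]]|[n /andP[pn qn]]].
  by exists (enc (m, n)); rewrite /= dec1K dec2K pm.
by split; [apply/pE|apply/qE]; [exists
  (dec1 nat_codeType nat_codeType n)|exists (dec2 nat_codeType nat_codeType n)].
Qed.

Lemma sigma1_or P Q : sigma1 P -> sigma1 Q -> sigma1 (fun a => P a \/ Q a).
Proof.
move=> [p cp pE] [q cq qE]; exists (fun x => p x || q x);
  first exact: computable_or.
move=> a; split=> [[/pE[n pn]|/qE[n qn]]|[n /orP[pn|qn]]].
- by exists n; rewrite pn.
- by exists n; rewrite qn orbT.
- by left; apply/pE; exists n.
- by right; apply/qE; exists n.
Qed.

(** Uniformization: the least number coding a witness together with a stage that certifies it is
    found by search, and the witness is returned. *)
Lemma sigma1_choice (P : A * B -> Prop) : sigma1 P ->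
  (forall a, exists b, P (a, b)) ->
  exists2 f : A -> B, computable f & forall a, P (a, f a).
Proof.
move=> [p cp pE] exP.
pose q (x : A * nat) := p ((x.1, dec1 B nat_codeType x.2), dec2 B nat_codeType x.2).
have cq : computable q.
  have cd : computable (fun x : A * nat => dec x.2 : B * nat).
    exact: computable_dec (computable_snd computable_id).
  apply: (computable_comp cp); apply: computable_pair (computable_snd cd).
  exact: computable_pair (computable_fst computable_id) (computable_fst cd).
have exq a : exists n, q (a, n).
  have [b /pE[n pn]] := exP a.
  by exists (enc (b, n)); rewrite /q /= dec1K dec2K.
pose g a := ex_minn (exq a).
have cg : computable g.
  apply: (computable_search cq) => [a|a m]; rewrite /g;
    case: ex_minnP => // s _ smin.
  by apply: contraL => /smin; rewrite leqNgt.
exists (fun a => dec1 B nat_codeType (g a));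
  first exact: computable_fst (computable_dec _ cg).
move=> a; apply/pE; exists (dec2 B nat_codeType (g a)).
by rewrite /g; case: ex_minnP.
Qed.

End Sigma1.

Ltac computable_step :=
  lazymatch goal with
  | |- computable (fun x => x) => exact: computable_id
  | |- computable (fun=> ?c) => exact: computable_const
  | |- computable (fun x => (@?f x, @?g x)) => apply: computable_pair
  | |- computable (fun x => (@?f x).+1) => apply: computable_succ
  | |- computable (fun x => (@?f x).-1) => apply: computable_pred
  | |- computable (fun x => addn (@?f x) (@?g x)) => apply: computable_add
  | |- computable (fun x => muln (@?f x) (@?g x)) => apply: computable_mul
  | |- computable (fun x => subn (@?f x) (@?g x)) => apply: computable_sub
  | |- computable (fun x => expn (@?f x) (@?g x)) => apply: computable_expn
  | |- computable (fun x => odd (@?f x)) => apply: computable_odd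
  | |- computable (fun x => ~~ (@?f x)) => apply: computable_not
  | |- computable (fun x => (@?f x) && (@?g x)) => apply: computable_and
  | |- computable (fun x => (@?f x) || (@?g x)) => apply: computable_or
  | |- computable (fun x => leq (@?f x) (@?g x)) => apply: computable_leq
  | |- computable (fun x => @eq_op _ (@?f x) (@?g x)) =>
      first [apply: computable_eq_bool | apply: computable_eq_str]
  | |- computable (fun x => size (@?f x)) => apply: computable_size
  | |- computable (fun x => take (@?f x) (@?g x)) => apply: computable_take
  | |- computable (fun x => drop (@?f x) (@?g x)) => apply: computable_drop
  | |- computable (fun x => cat (@?f x) (@?g x)) => apply: computable_cat
  | |- computable (fun x => nth false (@?f x) (@?g x)) => apply: computable_nth
  | |- computable (fun x => prefix (@?f x) (@?g x)) => apply: computable_prefix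
  | |- computable (fun x => str_code (@?f x)) => apply: computable_str_code
  | |- computable (fun x => str_decode (@?f x)) => apply: computable_str_decode

  | |- computable size => exact: (computable_size computable_id)
  | |- computable fst => exact: (computable_fst computable_id)
  | |- computable snd => exact: (computable_snd computable_id)
  | |- computable (fun x => (@?f x).1) => apply: computable_fst
  | |- computable (fun x => (@?f x).2) => apply: computable_snd
  | H : computable ?f |- computable ?f => exact: H
  | H : computable ?f |- computable (fun x => ?f (@?g x)) =>
    apply: (computable_comp H)
  | |- _ => apply: computable_if
  end.
Ltac computability := cbv beta; repeat (computable_step; cbv beta).

(** * Computable reals *)

Local Open Scope ring_scope.

Definition ratcode : Type := (nat * (nat * nat))%type.

Definition radd (p q : ratcode) : ratcode :=
  (p.1 * q.2.2.+1 + q.1 * p.2.2.+1,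
    (p.2.1 * q.2.2.+1 + q.2.1 * p.2.2.+1, p.2.2.+1 * q.2.2 + p.2.2))%N.
Definition ropp (q : ratcode) : ratcode := (q.2.1, (q.1, q.2.2)).
(** Meaningful only for positive values; the denominator a - b is stored minus one. *)
Definition rinv (q : ratcode) : ratcode := (q.2.2.+1, (0, q.1 - q.2.1.+1))%N.
Definition rhalf (n : nat) : ratcode := (1, (0, 2 ^ n - 1))%N.

Section Rval.
Context (R : realType).
Implicit Types x y : R.

Definition rval (q : ratcode) : R := (q.1%:R - q.2.1%:R) / q.2.2.+1%:R.

Lemma rval_radd p q : rval (radd p q) = rval p + rval q.
Proof.
case: p q => a [b c] [a' [b' c']]; rewrite /rval /=.
rewrite addf_div ?pnatr_eq0 // -!natrM; congr (_ / _).
  by rewrite !natrD !natrM; ring.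
by congr _%:R; rewrite mulnSr -addnS.
Qed.

Lemma rval_ropp q : rval (ropp q) = - rval q.
Proof. by rewrite /rval /= -mulNr opprB. Qed.

Lemma rval_rinv q : (q.2.1 < q.1)%N -> rval (rinv q) = (rval q)^-1.
Proof.
move=> ba; rewrite /rval /= subr0 invf_div; congr (_ / _).
by rewrite subnS prednK ?subn_gt0 // natrB // ltnW.
Qed.

Lemma rval_gt0 q : (0 < rval q) = (q.2.1 < q.1)%N.
Proof. by rewrite /rval pmulr_lgt0 ?invr_gt0 ?ltr0n // subr_gt0 ltr_nat. Qed.

Lemma rval_rhalf n : rval (rhalf n) = 2 ^- n.
Proof. by rewrite /rval /= subr0 div1r subn1 prednK ?expn_gt0 // natrX. Qed.

Lemma rval_lt p q : (rval p < rval q) =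
  (p.1 * q.2.2.+1 + q.2.1 * p.2.2.+1 < q.1 * p.2.2.+1 + p.2.1 * q.2.2.+1)%N.
Proof.
rewrite /rval ltr_pdivrMr ?ltr0n // mulrAC ltr_pdivlMr ?ltr0n //.
rewrite -(ltr_nat R) !natrD !natrM.
by rewrite -[LHS]subr_gt0 -[RHS]subr_gt0; congr (0 < _); ring.
Qed.

Lemma rval_dense x y : x < y -> exists q, x < rval q < y.
Proof.
move=> xy; have [r] := rat_in_itvoo xy.
rewrite in_itv /= => rxy.
have d0 : (0 < `|denq r|)%N by rewrite absz_gt0 denq_neq0.
exists (if 0 <= r then (`|numq r|%N, (0, `|denq r|.-1))%N
        else (0, (`|numq r|, `|denq r|.-1))%N).
suff -> : rval (if 0 <= r then (`|numq r|%N, (0, `|denq r|.-1))%N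
        else (0, (`|numq r|, `|denq r|.-1))%N) = ratr r by [].
have dE : `|denq r|%N%:R = (denq r)%:~R :> R.
  by rewrite pmulrn abszE gtr0_norm.
rewrite /ratr /rval; case: ifPn => r0 /=; rewrite prednK // dE.
  by rewrite subr0 pmulrn abszE ger0_norm // numq_ge0.
rewrite -ltNge in r0.
by rewrite sub0r pmulrn abszE ler0_norm ?numq_le0 ?ltW // mulrNz opprK.
Qed.

Lemma computable_rval_lt (A : codeType) (f g : A -> ratcode) :
  computable f -> computable g -> computable (fun a => rval (f a) < rval (g a)).
Proof.
move=> cf cg; under eq_fun do rewrite rval_lt.
computability.
Qed.

(** Both Dedekind cuts are enumerable. In contrast with the approximations of [computable_reals],
    closure under [ln], [expR] and sums then amounts to finding intermediate rationals;
    [computableR_of] and [computable_reals_of] translate between the two forms. *)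
Definition computableR (A : codeType) (x : A -> R) : Prop :=
  sigma1 (fun p : A * ratcode => rval p.2 < x p.1) /\
  sigma1 (fun p : A * ratcode => x p.1 < rval p.2).

End Rval.

(** * Enumerability of the cuts of the exponential at rational points *)

Section ExpCut.
Context (R : realType).
Implicit Types x y : R.

Lemma expr_ge1Mn x n : -1 <= x -> 1 + x *+ n <= (1 + x) ^+ n.
Proof.
move=> x1; elim: n => [|n IH]; first by rewrite mulr0n addr0 expr0.
rewrite exprSr; have x0 : 0 <= 1 + x by lra.
apply: le_trans (ler_wpM2r x0 IH).
rewrite mulrS -[x *+ n]mulr_natl; have n0 : 0 <= n%:R :> R by [].
by have := mulr_ge0 n0 (sqr_ge0 x); nra.
Qed.

(** The powers of 1 + x/m stay below exp x once the base is nonnegative and converge to it, which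
    replaces a comparison with exp x by a search among rational ones. *)
Lemma expR_lowerP x y :
  y < expR x <-> exists m, [/\ 0 < m%:R :> R, 0 <= 1 + x / m%:R & y <
    (1 + x / m%:R) ^+ m].
Proof.
split=> [yx|[m [m0 xm /lt_le_trans]]]; last first.
  have -> : expR x = expR (x / m%:R) ^+ m.
    by rewrite -expRM_natl mulrC divfK // lt0r_neq0.
  by apply; apply: lerXn2r; rewrite ?nnegrE ?expR_ge0 ?expR_ge1Dx.
have d0 : 0 < expR x - y by rewrite subr_gt0.
(* The first term gives |z| < 1 for z = x/m; the second makes the error exp(x) x^2 / m smaller than
   the gap exp x - y. *)
pose B := `|x| + expR x * x ^+ 2 / (expR x - y).
have B0 : 0 <= expR x * x ^+ 2 / (expR x - y).
  by apply: divr_ge0 (ltW d0); apply: mulr_ge0; [exact: expR_ge0|exact: sqr_ge0].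
have [m Bm] : exists m : nat, B < m%:R.
  by exists (Num.truncn B).+1; exact: truncnS_gt.
have xm : `|x| < m%:R by apply: le_lt_trans Bm; rewrite /B lerDl.
have m0 : 0 < m%:R :> R by apply: le_lt_trans xm.
pose z := x / m%:R.
have z1 : `|z| < 1 by rewrite /z normrM normfV (gtr0_norm m0) ltr_pdivrMr // mul1r.
have /andP[z1l z1r] : -1 < z < 1 by rewrite -ltr_norml.
exists m; rewrite -/z; split => //; first by lra.
have z2 : z ^+ 2 < 1 by rewrite -[ltRHS](expr1n _ 2) -real_normK ?num_real //
  ltrXn2r.
(* From exp(-z) >= 1 - z one gets exp(z) (1 - z) <= 1, then multiplies by 1 + z. The m-th power of
   this bound and Bernoulli's inequality give (1 + z)^m >= exp(x) (1 - x^2 / m). *)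
have ez : expR z * (1 - z ^+ 2) <= 1 + z.
  have := expR_ge1Dx (- z); rewrite expRN => h.
  have ez0 := expR_gt0 z.
  have : expR z * (1 - z) <= 1.
    by rewrite mulrC -ler_pdivlMr // mul1r.
  move=> h2; have z0 : 0 <= 1 + z by lra.
  have := ler_wpM2r z0 h2; rewrite mul1r; apply: le_trans.
  by rewrite le_eqVlt; apply/orP; left; apply/eqP; ring.
have le1 : (expR z * (1 - z ^+ 2)) ^+ m <= (1 + z) ^+ m.
  by apply: lerXn2r; rewrite ?nnegrE ?mulr_ge0 ?expR_ge0 //; lra.
apply: lt_le_trans le1; rewrite exprMn -expRM_natl.
have -> : m%:R * z = x by rewrite /z mulrC divfK // lt0r_neq0.
have z2N : -1 <= - z ^+ 2 by lra.
have := ler_wpM2l (expR_ge0 x) (expr_ge1Mn m z2N).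
apply: lt_le_trans; rewrite -mulr_natl.
have -> : m%:R * - z ^+ 2 = - (x ^+ 2 / m%:R).
  by rewrite /z; field; exact: lt0r_neq0.
have : expR x * x ^+ 2 / (expR x - y) < m%:R.
  by apply: le_lt_trans Bm; rewrite /B lerDr.
rewrite ltr_pdivrMr // => h.
have : expR x * (x ^+ 2 / m%:R) < expR x - y.
  by rewrite mulrA ltr_pdivrMr // [ltRHS]mulrC.
lra.
Qed.

Lemma sigma1_lt_expR :
  sigma1 (fun p : ratcode * ratcode => rval R p.1 < expR (rval R p.2)).
Proof.
(* [N] and [D] are numerator and denominator of 1 + x/m; the second test in [t] ensures that the
   truncated subtraction in [N] is exact. The third is the comparison with denominators cleared. *)
pose N (q : ratcode) m := (m * q.2.2.+1 + q.1 - q.2.1)%N.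
pose D (q : ratcode) m := (m * q.2.2.+1)%N.
pose t (x : (ratcode * ratcode) * nat) :=
  [&& 0 < x.2, x.1.2.2.1 <= D x.1.2 x.2 + x.1.2.1 &
    x.1.1.1 * D x.1.2 x.2 ^ x.2 < x.1.1.2.2.+1 * N x.1.2 x.2 ^ x.2
      + x.1.1.2.1 * D x.1.2 x.2 ^ x.2]%N.
exists t; first by rewrite /t /N /D; computability.
case=> -[qa [qb qc]] [a [b c]]; apply: (iff_trans (expR_lowerP _ _)).
suff tE m : [/\ 0 < m%:R :> R, 0 <= 1 + rval R (a, (b, c)) / m%:R
    & rval R (qa, (qb, qc)) < (1 + rval R (a, (b, c)) / m%:R) ^+ m]
    <-> t (((qa, (qb, qc)), (a, (b, c))), m).
  by split=> -[m /tE tm]; exists m.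
rewrite /t /= ltr0n; have [->|m0] := posnP m; first by split=> [[]|].
have D0 : (0 < m * c.+1)%N by rewrite muln_gt0 m0.
have D0R : 0 < (m * c.+1)%:R :> R by rewrite ltr0n.
have -> : 1 + rval R (a, (b, c)) / m%:R =
    ((m * c.+1 + a)%:R - b%:R) / (m * c.+1)%:R.
  have C0 : c.+1%:R != 0 :> R by rewrite pnatr_eq0.
  have M0 : m%:R != 0 :> R by rewrite pnatr_eq0 -lt0n.
  rewrite /rval /= natrD natrM; move: (c.+1%:R) C0 => C C0; field.
  by rewrite M0 C0.
rewrite pmulr_lge0 ?invr_gt0 // subr_ge0 ler_nat /D.
have [bD|bD] := leqP b (m * c.+1 + a); last by split=> [[]|].
rewrite -natrB // expr_div_n /rval /= -!natrX ltr_pdivrMr ?ltr0n //.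
rewrite mulrAC ltr_pdivlMr ?ltr0n ?expn_gt0 ?D0 // mulrBl ltrBlDr -!natrM -natrD.
by rewrite ltr_nat (mulnC ((_ - _) ^ _)%N); split=> [[]|].
Qed.

(** For positive p, exp q < p means 1/p < exp(-q). *)
Lemma sigma1_gt_expR :
  sigma1 (fun p : ratcode * ratcode => expR (rval R p.2) < rval R p.1).
Proof.
pose f (p : ratcode * ratcode) := (rinv p.1, ropp p.2).
have cf : computable f by rewrite /f /rinv /ropp; computability.
have cp : computable (fun p : ratcode * ratcode =>
  p.1.2.1 < p.1.1)%N by computability.
apply: sigma1_ext (sigma1_and (sigma1_dec cp) (sigma1_comp sigma1_lt_expR cf)).
case=> p q /=; rewrite rval_ropp expRN -(rval_gt0 R p); split=> [[p0]|h].
  by rewrite rval_rinv -?(rval_gt0 R) // ltf_pV2 ?posrE ?expR_gt0.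
have p0 : 0 < rval R p by apply: lt_trans h; exact: expR_gt0.
by rewrite rval_rinv -?(rval_gt0 R) // ltf_pV2 ?posrE ?expR_gt0.
Qed.

End ExpCut.

(** * Closure properties of computable families of reals *)

Section ComputableR.
Context (R : realType).
Implicit Types A B : codeType.
Local Notation rval := (rval R).

Lemma computableR_ext A (x y : A -> R) : x =1 y -> computableR x -> computableR y.
Proof. by move=> /funext ->. Qed.

Lemma computableR_comp A B (x : B -> R) (f : A -> B) :
  computableR x -> computable f -> computableR (fun a => x (f a)).
Proof.
move=> [lo hi] cf.
have cg : computable (fun p : A * ratcode => (f p.1, p.2)) by computability.
by split; [exact: sigma1_comp lo cg|exact: sigma1_comp hi cg].
Qed.

Lemma computableR_rval A (f : A -> ratcode) :
  computable f -> computableR (fun a => rval (f a)).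
Proof.
move=> cf; split; apply: sigma1_dec; apply: computable_rval_lt; computability.
Qed.

Lemma sigma1_exP A B (P : A -> B -> Prop) :
  sigma1 (fun p : A * B => P p.1 p.2) -> sigma1 (fun a => exists b, P a b).
Proof. exact: sigma1_ex. Qed.

Lemma computableR_opp A (x : A -> R) :
  computableR x -> computableR (fun a => - x a).
Proof.
move=> [lo hi].
have cg : computable (fun p : A * ratcode => (p.1, ropp p.2)).
  by rewrite /ropp; computability.
split.
- apply: sigma1_ext (sigma1_comp hi cg) => -[a q] /=.
  by rewrite rval_ropp ltrNr.
- apply: sigma1_ext (sigma1_comp lo cg) => -[a q] /=.
  by rewrite rval_ropp ltrNl.
Qed.

Lemma sigma1_lt_add A (x y : A -> R) :
  sigma1 (fun p : A * ratcode => rval p.2 < x p.1) ->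
  sigma1 (fun p : A * ratcode => rval p.2 < y p.1) ->
  sigma1 (fun p : A * ratcode => rval p.2 < x p.1 + y p.1).
Proof.
move=> sx sy.
pose P (p : A * ratcode) (r : ratcode * ratcode) :=
  (rval r.1 < x p.1 /\ rval r.2 < y p.1) /\ rval p.2 < rval (radd r.1 r.2).
apply: (@sigma1_ext _ (fun p => exists r, P p r)).
  case=> a q; rewrite /P /=; split=> [[[r s] /= [[rx sy']]]|qxy].
    by rewrite rval_radd => /lt_trans; apply; exact: ltrD.
  (* Each summand may lose half of the gap. *)
  have e0 : 0 < (x a + y a - rval q) / 2 by rewrite divr_gt0 // subr_gt0.
  have [r /andP[r1 r2]] := @rval_dense R (x a - (x a + y a - rval q) / 2)
    (x a) ltac:(lra).
  have [s /andP[s1 s2]] := @rval_dense R (y a - (x a + y a - rval q) / 2)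
    (y a) ltac:(lra).
  by exists (r, s); split => //=; rewrite rval_radd; lra.
apply: sigma1_exP; rewrite /P; apply: sigma1_and.
  apply: sigma1_and.
    apply: (sigma1_comp (f := fun z : (A * ratcode) * (ratcode * ratcode) =>
      (z.1.1, z.2.1)) sx); computability.
  apply: (sigma1_comp (f := fun z : (A * ratcode) * (ratcode * ratcode) =>
      (z.1.1, z.2.2)) sy); computability.
apply: sigma1_dec; apply: computable_rval_lt; rewrite /radd; computability.
Qed.

Lemma computableR_cutN A (x : A -> R) :
  sigma1 (fun p : A * ratcode => x p.1 < rval p.2) <->
  sigma1 (fun p : A * ratcode => rval p.2 < - x p.1).
Proof.
have cg : computable (fun p : A * ratcode => (p.1, ropp p.2)).
  by rewrite /ropp; computability.
split=> s.
- apply: sigma1_ext (sigma1_comp s cg) => -[a q] /=.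
  by rewrite rval_ropp ltrNr.
- apply: sigma1_ext (sigma1_comp s cg) => -[a q] /=.
  by rewrite rval_ropp ltrN2.
Qed.

Lemma computableR_add A (x y : A -> R) :
  computableR x -> computableR y -> computableR (fun a => x a + y a).
Proof.
move=> [lox /computableR_cutN hix] [loy /computableR_cutN hiy]; split.
  exact: sigma1_lt_add.
apply/(computableR_cutN (fun a => x a + y a));
  apply: sigma1_ext (sigma1_lt_add (x := fun a => - x a)
  (y := fun a => - y a) hix hiy) => -[a q] /=.
by rewrite opprD.
Qed.

Lemma computableR_sub A (x y : A -> R) :
  computableR x -> computableR y -> computableR (fun a => x a - y a).
Proof. by move=> cx cy; exact: computableR_add cx (computableR_opp cy). Qed.

Lemma computableR_if A (p : A -> bool) (x y : A -> R) :
  computable p -> computableR x -> computableR y ->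
  computableR (fun a => if p a then x a else y a).
Proof.
move=> cp [lox hix] [loy hiy].
have cp1 : computable (fun z : A * ratcode => p z.1) by computability.
have cp2 : computable (fun z : A * ratcode => ~~ p z.1) by computability.
split.
- apply: sigma1_ext (sigma1_or (sigma1_and (sigma1_dec cp1) lox)
    (sigma1_and (sigma1_dec cp2) loy)) => -[a q] /=.
  by case: (p a); split=> [[[]|[]]|] //; [left|right].
- apply: sigma1_ext (sigma1_or (sigma1_and (sigma1_dec cp1) hix)
    (sigma1_and (sigma1_dec cp2) hiy)) => -[a q] /=.
  by case: (p a); split=> [[[]|[]]|] //; [left|right].
Qed.

Lemma computableR_ln A (x : A -> R) :
  (forall a, 0 < x a) -> computableR x -> computableR (fun a => ln (x a)).
Proof.
move=> x0 [lo hi].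
have c1 : computable (fun z : (A * ratcode) * ratcode =>
  (z.1.1, z.2)) by computability.
have c2 : computable (fun z : (A * ratcode) * ratcode =>
  (z.2, z.1.2)) by computability.
split.
- apply: (@sigma1_ext _ (fun p : A * ratcode =>
    exists r : ratcode, rval r < x p.1 /\ expR (rval p.2) < rval r)).
    case=> a q /=.
    have -> : (rval q < ln (x a)) = (expR (rval q) < x a).
      by rewrite -[LHS]ltr_expR lnK ?posrE.
    split.
      by case=> r [rx qr]; exact: lt_trans rx.
    by move=> /(@rval_dense R)[r /andP[? ?]]; exists r.
  apply: sigma1_exP; exact: sigma1_and (sigma1_comp lo c1)
    (sigma1_comp (sigma1_gt_expR R) c2).
- apply: (@sigma1_ext _ (fun p : A * ratcode =>
    exists r : ratcode, x p.1 < rval r /\ rval r < expR (rval p.2))).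
    case=> a q /=.
    have -> : (ln (x a) < rval q) = (x a < expR (rval q)).
      by rewrite -[LHS]ltr_expR lnK ?posrE.
    split.
      by case=> r [rx qr]; exact: lt_trans qr.
    by move=> /(@rval_dense R)[r /andP[? ?]]; exists r.
  apply: sigma1_exP; exact: sigma1_and (sigma1_comp hi c1)
    (sigma1_comp (sigma1_lt_expR R) c2).
Qed.

Lemma computableR_exp A (x : A -> R) :
  computableR x -> computableR (fun a => expR (x a)).
Proof.
move=> [lo hi].
have c1 : computable (fun z : (A * ratcode) * ratcode =>
  (z.1.1, z.2)) by computability.
have c2 : computable (fun z : (A * ratcode) * ratcode =>
  (z.1.2, z.2)) by computability.
split.
- apply: (@sigma1_ext _ (fun p : A * ratcode =>
    exists r : ratcode, rval r < x p.1 /\ rval p.2 < expR (rval r))).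
    case=> a q /=; split=> [[r [rx qr]]|qx].
      by apply: lt_trans qr _; rewrite ltr_expR.
    (* A nonpositive [q] has no logarithm, but any rational below [x a] serves. *)
    have [q0|q0] := leP (rval q) 0.
      have [r /andP[_ rx]] := @rval_dense R (x a - 1) (x a) ltac:(lra).
      by exists r; split=> //; exact: le_lt_trans (expR_gt0 _).
    have : ln (rval q) < x a by rewrite -ltr_expR lnK.
    move=> /(@rval_dense R)[r /andP[qr rx]]; exists r; split=> //.
    by rewrite -[ltLHS]lnK ?posrE // ltr_expR.
  apply: sigma1_exP; exact: sigma1_and (sigma1_comp lo c1)
    (sigma1_comp (sigma1_lt_expR R) c2).
- apply: (@sigma1_ext _ (fun p : A * ratcode =>
    exists r : ratcode, x p.1 < rval r /\ expR (rval r) < rval p.2)).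
    case=> a q /=; split=> [[r [rx qr]]|qx].
      by apply: lt_trans qr; rewrite ltr_expR.
    have q0 : 0 < rval q by apply: lt_trans qx; exact: expR_gt0.
    have : x a < ln (rval q) by rewrite -ltr_expR lnK.
    move=> /(@rval_dense R)[r /andP[rx qr]]; exists r; split=> //.
    by rewrite -[ltRHS]lnK ?posrE // ltr_expR.
  apply: sigma1_exP; exact: sigma1_and (sigma1_comp hi c1)
    (sigma1_comp (sigma1_gt_expR R) c2).
Qed.

(** Through exp(ln x + ln y), which spares any separate estimate on the cuts of a product; quotients
    are treated likewise. *)
Lemma computableR_mul_pos A (x y : A -> R) :
  (forall a, 0 < x a) -> (forall a, 0 < y a) ->
  computableR x -> computableR y -> computableR (fun a => x a * y a).
Proof.
move=> x0 y0 cx cy.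
apply: computableR_ext (computableR_exp (computableR_add
  (computableR_ln x0 cx) (computableR_ln y0 cy))) => a.
by rewrite expRD !lnK ?posrE.
Qed.

Lemma computableR_div_pos A (x y : A -> R) :
  (forall a, 0 < x a) -> (forall a, 0 < y a) ->
  computableR x -> computableR y -> computableR (fun a => x a / y a).
Proof.
move=> x0 y0 cx cy.
apply: computableR_ext (computableR_exp (computableR_sub
  (computableR_ln x0 cx) (computableR_ln y0 cy))) => a.
by rewrite expRD expRN !lnK ?posrE.
Qed.

Lemma computableR_pospart A (x : A -> R) :
  computableR x -> computableR (fun a => Num.max (x a) 0).
Proof.
move=> [lo hi].
have c0 : computableR (fun _ : A * ratcode => rval (0, (0, 0))%N).
  by apply: computableR_rval; computability.
have cq : computable (fun p : A * ratcode => (0, (0, 0))%N :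
  ratcode) by computability.
have cp : computable (fun p : A * ratcode => p.2) by computability.
have r0 : rval (0, (0, 0))%N = 0 by rewrite /rval subrr mul0r.
split.
- apply: sigma1_ext (sigma1_or lo (sigma1_dec (computable_rval_lt R cp cq))) =>
  -[a q] /=.
  by rewrite r0 lt_max; split=> [[->|->]|/orP]; rewrite ?orbT.
- apply: sigma1_ext (sigma1_and hi (sigma1_dec
  (computable_rval_lt R cq cp))) => -[a q] /=.
  by rewrite r0 gt_max; split=> [[-> ->]|/andP].
Qed.

(* The sign of [y] cannot be decided, so [y] is split as a difference of two
   positive reals. *)
Lemma computableR_mul A (x y : A -> R) : (forall a, 0 < x a) ->
  computableR x -> computableR y -> computableR (fun a => x a * y a).
Proof.
move=> x0 cx cy.
have c1 : computableR (fun a : A => rval (1, (0, 0))%N).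
  by apply: computableR_rval; computability.
have r1 : rval (1, (0, 0))%N = 1 by rewrite /rval subr0 divr1.
have pos (z : A -> R) a : 0 < Num.max (z a) 0 + rval (1, (0, 0))%N.
  by rewrite r1 ltr_wpDl // le_max lexx orbT.
have cpos (z : A -> R) (cz : computableR z) := computableR_mul_pos x0 (pos z) cx
  (computableR_add (computableR_pospart cz) c1).
apply: computableR_ext (computableR_sub (cpos _ cy) (cpos _
  (computableR_opp cy))) => a.
rewrite -mulrBr; congr (_ * _); rewrite opprD addrACA subrr addr0.
by case: (leP (y a) 0) => y0; case: (leP (- y a) 0) => y1; lra.
Qed.

(** A rational lies below [x] exactly when it lies below some g - e. Errors under half the gap
    suffice, since [x] exceeds g - e by at most 2e. *)
Lemma computableR_approx A (x : A -> R) (g e : A * nat -> ratcode) :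
  computable g -> computable e ->
  (forall a n, `|x a - rval (g (a, n))| <= rval (e (a, n))) ->
  (forall a eps, 0 < eps -> exists n, rval (e (a, n)) < eps) ->
  computableR x.
Proof.
move=> cg ce xg e0; split.
- apply: (@sigma1_ext _ (fun p : A * ratcode => exists n : nat,
     rval (radd p.2 (e (p.1, n))) < rval (g (p.1, n)))).
    case=> a q /=; split=> [[n]|qx].
      rewrite rval_radd => h; have := xg a n; rewrite ler_norml => /andP[]; lra.
    have [n en] := e0 a ((x a - rval q) / 2) ltac:(lra).
    exists n; rewrite rval_radd; have := xg a n; rewrite ler_norml => /andP[]; lra.
  apply: sigma1_exP; apply: sigma1_dec; apply: computable_rval_lt;
    rewrite /radd; computability.
- apply: (@sigma1_ext _ (fun p : A * ratcode => exists n : nat,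
     rval (radd (g (p.1, n)) (e (p.1, n))) < rval p.2)).
    case=> a q /=; split=> [[n]|qx].
      rewrite rval_radd => h; have := xg a n; rewrite ler_norml => /andP[]; lra.
    have [n en] := e0 a ((rval q - x a) / 2) ltac:(lra).
    exists n; rewrite rval_radd; have := xg a n; rewrite ler_norml => /andP[]; lra.
  apply: sigma1_exP; apply: sigma1_dec; apply: computable_rval_lt;
    rewrite /radd; computability.
Qed.

Lemma computable_rhalf A (f : A -> nat) :
  computable f -> computable (fun a => rhalf (f a)).
Proof. by move=> cf; rewrite /rhalf; computability. Qed.

Lemma small_pow2 (eps : R) : 0 < eps -> exists n, 2 ^- n < eps.
Proof.
move=> e0; exists (Num.truncn eps^-1).+1.
rewrite invf_plt ?posrE ?exprn_gt0 //.
apply: lt_le_trans (truncnS_gt _) _; rewrite -natrX ler_nat ltnW //.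
exact: ltn_expl.
Qed.

(** Lying within 2^-n of [x] is an enumerable condition on a rational and always has a solution, so
    one can be selected computably. *)
Lemma computableR_approxP A (x : A -> R) : computableR x ->
  exists2 g : A * nat -> ratcode, computable g &
    forall a n, `|x a - rval (g (a, n))| <= 2 ^- n.
Proof.
move=> cx.
have ch : computable (fun z : A * nat => rhalf z.2).
  by apply: computable_rhalf; computability.
have cx1 : computableR (fun z : A * nat => x z.1).
  by apply: computableR_comp cx _; computability.
have cr := computableR_rval ch.
have [lo _] := computableR_add cx1 cr.
have [_ hi] := computableR_sub cx1 cr.
have ex (z : A * nat) : exists t, rval t < x z.1 + rval (rhalf z.2) /\
    x z.1 - rval (rhalf z.2) < rval t.
  rewrite rval_rhalf; have p0 : 0 < 2 ^- z.2 :> R by rewrite invr_gt0 exprn_gt0.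
  have [t /andP[t1 t2]] := @rval_dense R (x z.1 - 2 ^- z.2)
    (x z.1 + 2 ^- z.2) ltac:(lra).
  by exists t.
have [g cg gP] := sigma1_choice (sigma1_and lo hi) ex.
exists g => // a n; have /= := gP (a, n); rewrite rval_rhalf => -[].
by rewrite ler_norml => ? ?; apply/andP; split; lra.
Qed.

Lemma computableR_of A (x : A -> R) : computable_reals enc x -> computableR x.
Proof.
move=> [a [b [c [ra rb rc h]]]].
pose g (z : A * nat) : ratcode := (a [tuple enc z.1; z.2],
  (b [tuple enc z.1; z.2], c [tuple enc z.1; z.2])).
apply: (@computableR_approx _ x g (fun z => rhalf z.2)).
- have c1 : computable (fun z : A * nat => enc z.1) by apply: computable_enc;
  computability.
  have c2 : computable (fun z : A * nat => z.2) by computability.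
  by do 2?[apply: computable_pair]; exact: recursive2_computable.
- by apply: computable_rhalf; computability.
- by move=> i n; rewrite rval_rhalf; exact: h.
- by move=> i eps /small_pow2[n ?]; exists n; rewrite rval_rhalf.
Qed.

Lemma computable_reals_of A (x : A -> R) : computableR x -> computable_reals enc x.
Proof.
move=> /computableR_approxP[g cg gP].
pose h (p : nat * nat) := g (dec p.1, p.2).
have cd : computable (fun p : nat * nat => dec p.1 : A).
  by apply: computable_dec; computability.
have ch : computable h by rewrite /h; computability.
exists (fun v => (h (tnth v ord0, tnth v ord_max)).1),
  (fun v => (h (tnth v ord0, tnth v ord_max)).2.1),
  (fun v => (h (tnth v ord0, tnth v ord_max)).2.2).
split.
- by apply: (computable_recursive2 (f := fun p => (h p).1)); computability.
- by apply: (computable_recursive2 (f := fun p => (h p).2.1)); computability.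
- by apply: (computable_recursive2 (f := fun p => (h p).2.2)); computability.
- move=> i n /=; have := gP i n; rewrite /h /rval !(tnth_nth 0%N) /=.
  by rewrite encK.
Qed.

Lemma computableR_sum A (x : A * nat -> R) (k : A -> nat) :
  computableR x -> computable k ->
  computableR (fun a => \sum_(i < k a) x (a, i : nat)).
Proof.
move=> /computableR_approxP[g cg gP] ck.
pose r0 : ratcode := (0, (0, 0))%N.
(* The list is reversed so that passing from [N] to [N.+1] adds one outermost term, as primitive
   recursion needs. Errors add up to [k] times 2^-n. *)
pose F (z : A * nat) (N : nat) : ratcode :=
  foldr (fun i s => radd (g ((z.1, i), z.2)) s) r0 (rev (iota 0 N)).
have FS z n : F z n.+1 = radd (g ((z.1, n), z.2)) (F z n).
  by rewrite /F -addn1 iotaD rev_cat.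
have cF : computable (fun z : A * nat => F z (k z.1)).
  apply: (@computable_rec _ _ F (fun=> r0)
    (fun w => radd (g ((w.1.1, w.2.1), w.1.2)) w.2.2)) => //.
  - exact: computable_const.
  - by rewrite /radd; computability.
  - by computability.
pose e (z : A * nat) : ratcode := (k z.1, (0, 2 ^ z.2 - 1))%N.
have eE z : rval (e z) = (k z.1)%:R * 2 ^- z.2.
  by rewrite /rval /= subr0 subn1 prednK ?expn_gt0 // natrX.
apply: (@computableR_approx _ _ (fun z => F z (k z.1)) e) => //.
- by rewrite /e; computability.
- move=> a n; rewrite eE /=; elim: (k a) => [|m IH].
    by rewrite big_ord0 mul0r /F /= /rval subrr mul0r subrr normr0.
  rewrite big_ord_recr /= FS rval_radd /= -natr1 mulrDl mul1r.
  rewrite [rval _ + _]addrC opprD addrACA.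
  exact: le_trans (ler_normD _ _) (lerD IH (gP (a, m) n)).
- move=> a eps e0; have k0 : 0 < (k a).+1%:R :> R by rewrite ltr0n.
  have [n h] := small_pow2 (divr_gt0 e0 k0); exists n; rewrite eE /=.
  have p0 : 0 < 2 ^- n :> R by rewrite invr_gt0 exprn_gt0.
  move: h; rewrite ltr_pdivlMr // -natr1; nra.
Qed.

End ComputableR.

(** * Sums over binary strings, masses and levels *)

Local Open Scope classical_set_scope.
Local Open Scope charge_scope.

Fixpoint strs (n : nat) : seq (seq bool) :=
  if n is m.+1 then map (cons false) (strs m) ++ map (cons true) (strs m)
  else [:: [::]].

Lemma mem_strs n s : (s \in strs n) = (size s == n).
Proof.
elim: n s => [|n IH] s /=; first by rewrite inE; case: s.
rewrite mem_cat; case: s => [|b s]; first by apply/orP => -[] /mapP[].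
have inj c : injective (cons c : seq bool -> _) by move=> ? ? [].
have neq c d : c != d -> (c :: s \in map (cons d) (strs n)) = false.
  by move=> /eqP cd; apply/mapP => -[t _ [/cd]].
have eqc c : (c :: s \in map (cons c) (strs n)) = (s \in strs n).
  exact: mem_map (inj c) _ _.
by case: b; rewrite eqc neq //= ?orbF IH.
Qed.

Lemma uniq_strs n : uniq (strs n).
Proof.
elim: n => [//|n IH] /=; rewrite cat_uniq !map_inj_uniq ?IH /= ?andbT //;
  try by move=> ? ? [].
by apply/hasPn => _ /mapP[s _ ->]; apply/mapP => -[].
Qed.

Section BigStrs.
Context (R : realType).
Implicit Types F : seq bool -> R.

Lemma big_strsS n F : \sum_(s <- strs n.+1) F s =
  \sum_(s <- strs n) (F (false :: s) + F (true :: s)).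
Proof. by rewrite /= big_cat !big_map [RHS]big_split. Qed.

Lemma big_strs_cat m n F : \sum_(s <- strs (m + n)) F s =
  \sum_(s <- strs m) \sum_(t <- strs n) F (s ++ t).
Proof.
elim: m F => [|m IH] F; first by rewrite big_seq1.
by rewrite addSn !big_strsS IH; apply: eq_bigr => s _; rewrite big_split.
Qed.

Lemma big_strs_rcons n F : \sum_(s <- strs n.+1) F s =
  \sum_(s <- strs n) (F (rcons s false) + F (rcons s true)).
Proof.
rewrite -addn1 big_strs_cat; apply: eq_bigr => s _.
by rewrite big_strsS big_seq1 !cats1.
Qed.

End BigStrs.

Lemma integral_finite_valued d (T : measurableType d) (R : realType)
    (P : probability T R) n (p : T -> seq bool) (F : seq bool -> R) :
  (forall x, size (p x) = n) -> (forall s, measurable (p @^-1` [set s])) ->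
  (\int[P]_x (F (p x))%:E =
   (\sum_(s <- strs n) F s * fine (P (p @^-1` [set s])))%:E)%E.
Proof.
move=> sp mp.
pose f s x : \bar R := ((F s)%:E * (\1_(p @^-1` [set s]) x)%:E)%E.
have If s : P.-integrable setT (fun x => (\1_(p @^-1` [set s]) x)%:E).
  by apply: integrable_indic => //; rewrite setTI; exact: fin_num_measure.
rewrite (eq_integral (fun x => \sum_(s <- strs n) f s x)%E); last first.
  move=> x _; rewrite (bigD1_seq (p x)) ?mem_strs ?sp ?uniq_strs //=.
  rewrite big1 ?adde0; last first.
    move=> s sx; rewrite /f indicE (_ : _ \in _ = false) ?mule0 //.
    by apply/negbTE; rewrite notin_setE /= => /eqP; rewrite eq_sym (negbTE sx).
  by rewrite /f indicE mem_set //= mule1.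
rewrite integral_sum //; last by move=> s; exact: integrableZl.
rewrite -sumEFin; apply: eq_bigr => s _.
rewrite integralZl // integral_indic // setIT EFinM fineK //.
exact: fin_num_measure.
Qed.

Lemma measure_finite_valued d (T : measurableType d) (R : realType)
    (P : probability T R) n (p : T -> seq bool) (a : pred (seq bool)) :
  (forall x, size (p x) = n) -> (forall s, measurable (p @^-1` [set s])) ->
  measurable [set x | a (p x)] ->
  P [set x | a (p x)] =
    (\sum_(s <- strs n) (a s)%:R * fine (P (p @^-1` [set s])))%:E.
Proof.
move=> sp mp ma; rewrite -(@integral_finite_valued _ _ _ P n p (fun s =>
  (a s)%:R)) //.
rewrite -[X in P X]setIT -(@integral_indic _ _ R P setT) //.
apply: eq_integral => w _; rewrite indicE; congr ((nat_of_bool _)%:R%:E).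
by apply/idP/idP; rewrite inE.
Qed.

(** Strings are indexed by their codes so that the union is visibly countable. *)
Lemma level_bigcup n (A : set (seq bool)) :
  [set w : cantor | A (mkseq w n)] =
  \bigcup_(i in [set i | A (str_decode i) /\ size (str_decode i) = n])
    cyl (str_decode i).
Proof.
apply/seteqP; split=> [w Aw|w [i [Ai iN]]].
  by exists (str_code (mkseq w n)); rewrite /cyl/= str_codeK size_mkseq.
by rewrite /cyl /= iN => ->.
Qed.

Lemma measurable_level n (A : set (seq bool)) :
  measurable [set w : cantor | A (mkseq w n)].
Proof.
by rewrite level_bigcup; apply: bigcup_measurable => i _; exact: measurable_cyl.
Qed.

Lemma measurable_levelF n (A : set (seq bool)) :
  measurable ([set w : cantorF n | A (mkseq w n)]).
Proof.
rewrite [X in measurable X]level_bigcup; apply: bigcup_measurable => i [_ iN].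
by apply: sub_sigma_algebra; exists (str_decode i).
Qed.

(** The sets that do not separate points agreeing on [n] bits form a sigma-algebra containing the
    generating cylinders. *)
Lemma measurableF_saturated n (B : set (cantorF n)) : measurable B ->
  forall w w' : cantorF n, mkseq w n = mkseq w' n -> B w -> B w'.
Proof.
move=> mB.
suff H : forall w w' : cantorF n, mkseq w n = mkseq w' n -> (B w <-> B w').
  by move=> w w' e /(H _ _ e).
apply: (mB [set B : set (cantorF n) | forall w w' : cantorF n,
  mkseq w n = mkseq w' n -> (B w <-> B w')]); split; first split.
- by [].
- by move=> A satA w w' /satA H; split=> -[_ nA]; split=> // /H.
- by move=> F satF w w' e; split=> -[i _ Fi]; exists i => //; apply/(satF i _ _ e).
- move=> _ [s sn <-] w w' e; change (mkseq w (size s) = s <-> mkseq w'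
  (size s) = s).
  by rewrite sn e.
Qed.

Section Mass.
Context (R : realType) (nu : probability cantor R).

Lemma nu_cyl s : nu (cyl s) = (mass nu s)%:E.
Proof. by rewrite /mass fineK // fin_num_measure //; exact: measurable_cyl. Qed.

Lemma mass_nil : mass nu [::] = 1.
Proof.
rewrite /mass (_ : cyl [::] = setT) ?probability_setT //.
by apply/seteqP; split.
Qed.

Lemma mkseqS_rcons T (f : nat -> T) n : mkseq f n.+1 = rcons (mkseq f n) (f n).
Proof. by rewrite /mkseq -addn1 iotaD map_cat /= cats1. Qed.

Lemma mass_rcons s : mass nu s = mass nu (rcons s false) + mass nu (rcons s true).
Proof.
have e b w : cyl (rcons s b) w <-> cyl s w /\ w (size s) = b.
  rewrite /cyl /= size_rcons mkseqS_rcons.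
  by split=> [/eqP|[-> ->]//]; rewrite eqseq_rcons => /andP[/eqP -> /eqP ->].
apply: EFin_inj; rewrite EFinD -!nu_cyl -measureU; [|exact: measurable_cyl..|].
  congr (nu _); apply/seteqP; split=> w; last by case=> /e[].
  by case E : (w (size s)) => sw; [right|left]; apply/e.
by apply/seteqP; split=> // w [/e[_ w0] /e[_]]; rewrite w0.
Qed.

Lemma expectation_strs n (F : seq bool -> R) :
  ('E_nu[fun w => F (mkseq w n)] = (\sum_(s <- strs n) F s * mass nu s)%:E)%E.
Proof.
rewrite unlock.
rewrite (@integral_finite_valued _ cantor R nu n (fun w => mkseq w n));
  last 2 first.
- by move=> w; rewrite size_mkseq.
- by move=> s; exact: (@measurable_level n [set s]).
congr (_%:E); apply: eq_big_seq => s; rewrite mem_strs => /eqP <-.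
by [].
Qed.

Lemma measure_level n (p : pred (seq bool)) :
  nu [set w | p (mkseq w n)] = (\sum_(s <- strs n) (p s)%:R * mass nu s)%:E.
Proof.
rewrite (@measure_finite_valued _ cantor R nu n (fun w => mkseq w n)).
- congr (_%:E); apply: eq_big_seq => s; rewrite mem_strs => /eqP <-.
  by [].
- by move=> w; rewrite size_mkseq.
- by move=> s; exact: (@measurable_level n [set s]).
- exact: (@measurable_level n p).
Qed.
End Mass.

(** * The Kullback-Leibler divergence of conditional measures *)

Lemma measurable_fun_levelF n d (Y : sigmaRingType d) (g : cantorF n -> Y) :
  (forall w w', mkseq w n = mkseq w' n -> g w = g w') -> measurable_fun setT g.
Proof.
move=> gE _ B mB; rewrite setTI.
rewrite (_ : g @^-1` B = [set w : cantorF n |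
    [set t | exists2 w', mkseq w' n = t & B (g w')] (mkseq w n)]).
  exact: measurable_levelF.
apply/seteqP; split=> [w Bw|w [w' /gE -> //]].
by exists w.
Qed.

(** The divergence over the next [l] bits, conditioned on [s]. It is stated for mass functions
    rather than measures, so that it can be studied for [tilt] before a measure with these masses is
    constructed. *)
Definition block_kl (R : realType) (N M : seq bool -> R) l s : R :=
  \sum_(t <- strs l) N (s ++ t) / N s * ln ((N (s ++ t) / N s) / (M
    (s ++ t) / M s)).

Section KLblock.
Context (R : realType).
Implicit Types nu mu : probability cantor R.

Lemma conditionalE nu s A : full_support nu ->
  conditional nu s A = (nu (A `&` cyl s) * (mass nu s)^-1%:E)%E.
Proof.
move=> fs; rewrite -[LHS]/(mnormalize (mrestr nu (measurable_cyl s)) nu A).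
rewrite /mnormalize /= /mrestr /= setTI nu_cyl /=.
by rewrite eqe orbF gt_eqF.
Qed.

Lemma distributionE nu s m A : full_support nu ->
  distribution (conditional nu s) (@toF m) A =
  (nu (A `&` cyl s) * (mass nu s)^-1%:E)%E.
Proof. by move=> fs; rewrite -conditionalE. Qed.

Lemma cyl_mkseq (w : cantor) n : cyl (mkseq w n) w.
Proof. by rewrite /cyl /= size_mkseq. Qed.

Lemma cyl_prefix s t (w : cantor) : cyl t w -> (size s <= size t)%N ->
  prefix s t = (mkseq w (size s) == s).
Proof.
rewrite /cyl /= prefixE => <-; rewrite size_mkseq => st.
by rewrite /mkseq -map_take take_iota (minn_idPl st).
Qed.

Lemma distribution_cyl nu s t m : full_support nu -> size t = m ->
  (size s <= m)%N -> distribution (conditional nu s) (@toF m) (cyl t) =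
  (if prefix s t then mass nu t / mass nu s else 0)%:E.
Proof.
move=> fs tm sm; rewrite distributionE //; case: ifPn => st.
  rewrite (_ : cyl t `&` cyl s = cyl t) ?nu_cyl -?EFinM //.
  apply/seteqP; split=> [w []//|w tw]; split=> //.
  by apply/eqP; rewrite -(cyl_prefix tw) // tm.
rewrite (_ : cyl t `&` cyl s = set0) ?measure0 ?mul0e //.
apply/seteqP; split=> // w [tw /eqP]; rewrite -(cyl_prefix tw) ?tm //.
by move/negP: st.
Qed.

Lemma measurable_cylF m t : size t = m -> measurable (cyl t : set (cantorF m)).
Proof. by move=> tm; apply: sub_sigma_algebra; exists t. Qed.

Lemma probability_levelF m (P : probability (cantorF m) R) (p : seq bool -> R) A :
  (forall t, size t = m -> P (cyl t) = (p t)%:E) -> measurable A ->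
  P A = (\sum_(t <- strs m) (`[< exists2 x, mkseq x m = t & A x >])%:R * p t)%:E.
Proof.
move=> Pp mA.
rewrite -[LHS]/(P [set x | A x]).
have -> : A = [set x | `[< exists2 y, mkseq y m = mkseq x m & A y >]].
  apply/seteqP; split=> x /=; first by move=> Ax; apply/asboolP; exists x.
  by move=> /asboolP[y yx]; exact: measurableF_saturated.
rewrite (@measure_finite_valued _ _ _ P m (fun x => mkseq x m)
  (fun t => `[< exists2 y, mkseq y m = t & A y >])).
- congr (_%:E); apply: eq_big_seq => t; rewrite mem_strs => /eqP tm.
  have -> : (fun x : cantorF m => mkseq x m) @^-1` [set t] = cyl t.
    by rewrite /cyl tm.
  rewrite Pp //=; congr ((nat_of_bool _)%:R * _).
  apply: asbool_equiv_eq; split=> -[x xt Ax]; exists x => //=.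
    by apply/asboolP; exists x.
  by move: Ax => /asboolP[y yx]; exact: measurableF_saturated.
- by move=> x; rewrite size_mkseq.
- by move=> t; exact: (@measurable_levelF m [set t]).
- exact: (@measurable_levelF m (fun t => `[< exists2 y, mkseq y m = t & A y >])).
Qed.

(** The Radon-Nikodym derivative is measurable for a finite algebra, hence constant on each cylinder
    of length [m]; integrating it over a cylinder with [q] nonzero identifies the constant as
    p/q. *)
Lemma KL_levels m (P Q : probability (cantorF m) R) (p q : seq bool -> R) :
  (forall t, size t = m -> P (cyl t) = (p t)%:E) ->
  (forall t, size t = m -> Q (cyl t) = (q t)%:E) ->
  (forall t, 0 <= p t) -> (forall t, 0 <= q t) -> (forall t, q t = 0 -> p t = 0) ->
  KL P Q = (\sum_(t <- strs m) p t * ln (p t / q t))%:E.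
Proof.
move=> Pp Qq p0 q0 qp.
have PQ : P `<< Q.
  apply/null_content_dominatesP => A mA QA0.
  have := probability_levelF Qq mA; rewrite [LHS]QA0 => -[/esym/eqP].
  rewrite psumr_eq0; last by move=> t _; rewrite mulr_ge0.
  move=> /allP h; rewrite [LHS](probability_levelF Pp mA); congr (_%:E).
  apply: big1_seq => t /andP[_ /h]; rewrite mulf_eq0 => /orP[/eqP ->|/eqP/qp ->].
    by rewrite mul0r.
  by rewrite mulr0.
rewrite /KL; set f := 'd _ '/d Q.
have fint : Q.-integrable setT f by exact: Radon_Nikodym_integrable.
have mf := measurable_int _ fint.
have fsat (x y : cantorF m) : mkseq x m = mkseq y m -> f x = f y.
  move=> xy; have mB : measurable (f @^-1` [set f x]).
    by rewrite -[X in measurable X]setTI; exact: mf.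
  by have := measurableF_saturated mB xy erefl.
have fE (x : cantorF m) : q (mkseq x m) != 0 ->
    f x = (p (mkseq x m) / q (mkseq x m))%:E.
  move=> qx; pose t := mkseq x m; have tm : size t = m by rewrite size_mkseq.
  have mt := measurable_cylF tm.
  have := @Radon_Nikodym_integral _ _ R (charge_of_finite_measure P) Q _ PQ mt.
  rewrite (eq_integral (cst (f x))); last first.
    by move=> y; rewrite inE => ty; apply: fsat; rewrite -/t -ty tm.
  rewrite integral_cst // [LHS](Pp t tm) [X in (_ * X)%E](Qq t tm).
  have ffin : f x \is a fin_num by exact: Radon_Nikodym_fin_num.
  rewrite -(fineK ffin) -EFinM => -[->]; congr (_%:E).
  by rewrite mulfK.
transitivity (\int[P]_x (ln (p (mkseq x m) / q (mkseq x m)))%:E)%E.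
  apply: ae_eq_integral => //.
  - by apply: measurable_fun_levelF => x y /fsat ->.
  - by apply: measurable_fun_levelF => x y ->.
  (* Off this [P]-null set both [p] and [q] are positive, and the two integrands agree. *)
  have mN := @measurable_levelF m [set t | p t = 0].
  exists [set x : cantorF m | p (mkseq x m) = 0]; split => //.
  - rewrite [LHS](probability_levelF Pp mN); congr (_%:E).
    apply: big1_seq => t _; case: asboolP => [[x <- /= ->]|_];
      rewrite ?mulr0 ?mul0r //.
  - move=> x /= h; apply: contrapT => px; apply: h => _.
    have qx : q (mkseq x m) != 0 by apply/eqP => /qp.
    rewrite fE // lne_EFin // divr_gt0 // lt0r ?q0 ?qx // p0 andbT.
    exact/eqP.
rewrite (@integral_finite_valued _ _ _ P m (fun x => mkseq x m)
  (fun t => ln (p t / q t))).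
- congr (_%:E); apply: eq_big_seq => t; rewrite mem_strs => /eqP tm.
  have -> : (fun x : cantorF m => mkseq x m) @^-1` [set t] = cyl t.
    by rewrite /cyl tm.
  by rewrite Pp // mulrC.
- by move=> x; rewrite size_mkseq.
- by move=> t; exact: (@measurable_levelF m [set t]).
Qed.

Lemma KL_F_block nu mu n l w : full_support nu -> full_support mu ->
  KL_F nu mu n (n + l) w = (block_kl (mass nu) (mass mu) l (mkseq w n))%:E.
Proof.
move=> fn fm; set s := mkseq w n.
have ss : size s = n by rewrite size_mkseq.
have sm : (size s <= n + l)%N by rewrite ss leq_addr.
rewrite /KL_F (KL_levels (fun t => distribution_cyl fn ^~ sm)
  (fun t => distribution_cyl fm ^~ sm)).
(* Only the strings extending [s] are charged by the conditional measures. *)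
- congr (_%:E); rewrite big_strs_cat (bigD1_seq s) ?uniq_strs ?mem_strs ?ss //=.
  rewrite [X in _ + X]big1_seq ?addr0; last first.
    move=> t /andP[ts]; rewrite mem_strs => /eqP tn; apply: big1 => u _.
    by rewrite prefixE take_size_cat ?ss -?tn // (negbTE ts) mul0r.
  by apply: eq_big_seq => t _; rewrite prefix_prefix.
- by move=> t; case: ifP => // _; rewrite divr_ge0 // ltW.
- by move=> t; case: ifP => // _; rewrite divr_ge0 // ltW.
- by move=> t; case: ifP => // _ /eqP; rewrite mulf_eq0 invr_eq0 !gt_eqF.
Qed.

End KLblock.

(** * Measures with prescribed masses *)

(** Otherwise, for each n, some point outside [U] agrees with [w] on n bits; these points converge
    to [w] coordinatewise, contradicting openness. *)
Lemma cyl_nbhs (U : set cantor_space) (w : cantor_space) :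
  open U -> U w -> exists n, cyl (mkseq w n) `<=` U.
Proof.
move=> oU Uw; apply: contrapT => /forallNP noU.
have /choice[v vP] : forall n, exists v : cantor_space, cyl (mkseq w n) v /\ ~ U v.
  move=> n; apply: contrapT => /forallNP h; apply: (noU n) => v nv.
  by apply: contrapT => nUv; exact: (h v).
have vw : v @ \oo --> w.
  apply/cvg_sup => i V [W [[B oB <-] Ow] WV].
  exists i.+1 => // n /= ni; apply: WV => /=.
  have [nv _] := vP n.
  have := congr1 (fun s => nth false s i) nv.
  by rewrite size_mkseq !nth_mkseq // => /= ->.
have [N _ /(_ N (leqnn N))] := vw U (open_nbhs_nbhs (conj oU Uw)).
by case: (vP N).
Qed.

Lemma open_bigcup_cyl (U : set cantor_space) : open U ->
  U = \bigcup_(i in [set i | cyl (str_decode i) `<=` U]) cyl (str_decode i).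
Proof.
move=> oU; apply/seteqP; split=> [w Uw|w [i /= iU /iU //]].
have [n nU] := cyl_nbhs oU Uw.
exists (str_code (mkseq w n)); rewrite /= str_codeK //.
exact: cyl_mkseq.
Qed.

Lemma measurable_fun_cantor d (T : measurableType d) (f : T -> cantor) :
  (forall s, measurable (f @^-1` cyl s)) -> measurable_fun setT f.
Proof.
move=> mf; apply: (@measurability _ _ T cantor setT f (@open cantor_space) erefl).
move=> _ [U oU <-].
rewrite setTI (open_bigcup_cyl oU) preimage_bigcup.
by apply: bigcup_measurable => i _; exact: mf.
Qed.

(** * Existence of a measure with given masses, by transport of Lebesgue measure *)

Section Quantile.
Context (R : realType) (m : seq bool -> R).
Hypothesis m0 : forall s, 0 <= m s.
Hypothesis m_nil : m [::] = 1.
Hypothesis m_rcons : forall s, m s = m (rcons s false) + m (rcons s true).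

(** For additive [m], the total mass of the strings of the same length that precede [s]
    lexicographically, grouped by the first position where they differ from [s]. *)
Definition left_end (s : seq bool) : R :=
  \sum_(i < size s) (if nth false s i then m (rcons (take i s) false) else 0).

Lemma left_end_rcons s b :
  left_end (rcons s b) = left_end s + (if b then m (rcons s false) else 0).
Proof.
rewrite /left_end size_rcons big_ord_recr /= nth_rcons ltnn eqxx.
rewrite -cats1 take_size_cat //; congr (_ + _); apply: eq_bigr => i _.
by rewrite nth_cat ltn_ord takel_cat // ltnW.
Qed.

Fixpoint quantile_path (x : R) (n : nat) : seq bool :=
  if n is k.+1 then
    let s := quantile_path x k in rcons s (left_end s + m (rcons s false) <= x)
  else [::].

(* The quantile map, which transports the Lebesgue measure on [[0, 1[] to the
   measure with masses [m]: the points of [[0, 1[] sent to the cylinder of [s]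
   form an interval of length [m s]. *)
Definition quantile (x : R) : cantor := fun n =>
  left_end (quantile_path x n) + m (rcons (quantile_path x n) false) <= x.

Lemma mkseq_quantile x n : mkseq (quantile x) n = quantile_path x n.
Proof. by elim: n => [//|n IH]; rewrite mkseqS_rcons IH. Qed.

Lemma cyl_quantile_rcons x s b : cyl (rcons s b) (quantile x) <->
  cyl s (quantile x) /\ (left_end s + m (rcons s false) <= x) = b.
Proof.
rewrite /cyl /= size_rcons !mkseq_quantile /=; split.
  by move=> /eqP; rewrite eqseq_rcons => /andP[/eqP -> /eqP ->].
by move=> [-> ->].
Qed.

Lemma measurable_quantile :
  measurable_fun setT (quantile : measurableTypeR R -> cantor).
Proof.
apply: measurable_fun_cantor; elim/last_ind => [|s b IH].
  by rewrite (_ : _ @^-1` _ = setT) //; apply/seteqP; split.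
rewrite (_ : _ @^-1` _ = (quantile @^-1` cyl s) `&`
  (if b then `[left_end s + m (rcons s false), +oo[%classic
   else `]-oo, left_end s + m (rcons s false)[%classic)).
  by apply: measurableI => //; case: b; exact: measurable_itv.
apply/seteqP; split=> x /=.
  move=> /cyl_quantile_rcons[sx <-]; split=> //.
  by case: leP => h; rewrite /= in_itv /= ?h.
move=> [sx xb]; apply/cyl_quantile_rcons; split=> //.
by case: b xb; rewrite /= in_itv /= ?andbT // => h; apply/negbTE; rewrite -ltNge.
Qed.

Lemma cyl_quantileE s x : 0 <= x < 1 ->
  cyl s (quantile x) <-> left_end s <= x < left_end s + m s.
Proof.
move=> x01; elim/last_ind: s => [|s b IH].
  by rewrite /left_end big_ord0 m_nil add0r x01.
apply: (iff_trans (cyl_quantile_rcons _ _ _));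
  rewrite IH left_end_rcons (m_rcons s).
have := m0 (rcons s false); have := m0 (rcons s true).
case: b => h0 h1; split.
- by move=> [/andP[? ?] ?]; apply/andP; split=> //; lra.
- by move=> /andP[? ?]; split; [apply/andP; split|]; lra.
- by rewrite addr0 => -[/andP[-> ?] /negbT]; rewrite -ltNge.
- move=> /andP[? ?]; split; [apply/andP; split|apply/negbTE; rewrite -ltNge]; lra.
Qed.

Lemma left_end_bounds s : 0 <= left_end s /\ left_end s + m s <= 1.
Proof.
elim/last_ind: s => [|s b [IH0 IH1]].
  by rewrite /left_end big_ord0 m_nil add0r.
rewrite left_end_rcons; move: IH1; rewrite (m_rcons s).
have := m0 (rcons s false); have := m0 (rcons s true).
by case: b => *; split; lra.
Qed.

Let unit_itv : set R := `[0, 1[%classic.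
Let measurable_unit_itv : measurable unit_itv := measurable_itv _.
Let lebesgue01 : probability (measurableTypeR R) R :=
  mnormalize (mrestr lebesgue_measure measurable_unit_itv) (uniform_prob
    (@ltr01 R)).

Lemma probability_of_masses :
  exists mu : probability cantor R, forall s, mass mu s = m s.
Proof.
pose X : {mfun measurableTypeR R >-> cantor} := HB.pack (quantile :
  measurableTypeR R -> cantor)
  (isMeasurableFun.Build _ _ (measurableTypeR R) cantor quantile
    measurable_quantile).
exists (distribution lebesgue01 X) => s.
rewrite /mass -[X in fine X]/(mnormalize
  (mrestr lebesgue_measure measurable_unit_itv)
   (uniform_prob (@ltr01 R)) (quantile @^-1` cyl s)).
rewrite /mnormalize /= /mrestr /= setTI.
have [l0 l1] := left_end_bounds s.
have -> : lebesgue_measure unit_itv = 1%:E.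
  by rewrite lebesgue_measure_itv /= lte_fin ltr01 oppr0 adde0.
rewrite eqe oner_eq0 /= invr1 mule1.
have -> : quantile @^-1` cyl s `&` unit_itv = `[left_end s, left_end s + m
  s[%classic.
  apply/seteqP; split=> x /=; rewrite !in_itv /=.
    by move=> [sx x01]; apply/cyl_quantileE.
  move=> xs; have x01 : 0 <= x < 1.
    by move: xs => /andP[? ?]; apply/andP; split; lra.
  by split=> //; apply/cyl_quantileE.
rewrite lebesgue_measure_itv /= lte_fin; case: ltP => h.
  by rewrite -EFinB /= addrAC subrr add0r.
by have := m0 s; move: h; rewrite /=; lra.
Qed.

End Quantile.

(** * Blockwise divergences and tilted measures *)

Section BlockKL.
Context (R : realType) (N M : seq bool -> R).
Hypotheses (N0 : forall s, 0 < N s) (M0 : forall s, 0 < M s).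
Hypothesis N_rcons : forall s, N s = N (rcons s false) + N (rcons s true).
Hypothesis M_rcons : forall s, M s = M (rcons s false) + M (rcons s true).

Lemma ln_ge1BV (x : R) : 0 < x -> 1 - x^-1 <= ln x.
Proof.
move=> x0; have := @le_ln1Dx R (x^-1 - 1).
rewrite addrCA subrr addr0 lnV ?posrE // => h.
have : -1 < x^-1 - 1 by rewrite ltrBrDr addNr invr_gt0.
by move=> /h; lra.
Qed.

Lemma sum_strs_cat (F : seq bool -> R) l s :
  (forall s, F s = F (rcons s false) + F (rcons s true)) ->
  \sum_(t <- strs l) F (s ++ t) = F s.
Proof.
move=> Fr; elim: l s => [|l IH] s; first by rewrite big_seq1 cats0.
rewrite big_strs_rcons -[RHS]IH; apply: eq_bigr => t _.
by rewrite [RHS]Fr !rcons_cat.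
Qed.

(** Gibbs' inequality: by ln x >= 1 - 1/x each term p ln(p/q) is at least p - q, and both families
    of conditional probabilities sum to 1. *)
Lemma block_kl_ge0 l s : 0 <= block_kl N M l s.
Proof.
have dN t : 0 < N (s ++ t) / N s by rewrite divr_gt0.
have dM t : 0 < M (s ++ t) / M s by rewrite divr_gt0.
apply: (@le_trans _ _ (\sum_(t <- strs l) (N (s ++ t) / N s - M (s ++ t) / M s))).
  rewrite sumrB -!mulr_suml !sum_strs_cat // !divff ?subrr //; exact: lt0r_neq0.
rewrite /block_kl; apply: ler_sum => t _.
have := ler_wpM2l (ltW (dN t)) (ln_ge1BV (divr_gt0 (dN t) (dM t))).
apply: le_trans; rewrite mulrBr mulr1 invf_div mulrCA divff ?mulr1 //.
exact: lt0r_neq0.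
Qed.

Lemma block_kl_chain k l s : block_kl N M (k + l) s =
  block_kl N M k s + \sum_(t <- strs k) N (s ++ t) / N s * block_kl N M l (s ++ t).
Proof.
rewrite /block_kl big_strs_cat -big_split; apply: eq_bigr => t _ /=.
have n0 u : N u != 0 by exact: lt0r_neq0.
have m0 u : M u != 0 by exact: lt0r_neq0.
(* The mass of [s ++ t] is spread over its extensions by [l] bits, so that both sides become sums
   over the same strings. *)
have -> : N (s ++ t) / N s * ln (N (s ++ t) / N s / (M (s ++ t) / M s)) =
    \sum_(u <- strs l) N ((s ++ t) ++ u) / N s * ln (N (s ++ t) / N s / (M
      (s ++ t) / M s)).
  by rewrite -!mulr_suml sum_strs_cat.
rewrite mulr_sumr -big_split; apply: eq_bigr => u _ /=.
rewrite catA.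
have -> : N (s ++ t) / N s * (N ((s ++ t) ++ u) / N (s ++ t) *
    ln (N ((s ++ t) ++ u) / N (s ++ t) / (M ((s ++ t) ++ u) / M (s ++ t)))) =
  N ((s ++ t) ++ u) / N s *
    ln (N ((s ++ t) ++ u) / N (s ++ t) / (M ((s ++ t) ++ u) / M (s ++ t))).
  by field; rewrite !n0.
rewrite -mulrDr -lnM ?posrE ?divr_gt0 //; congr (_ * ln _).
by field; rewrite !n0 !m0.
Qed.

(** By the chain rule the remaining bits add a nonnegative amount; lower bounds for all block
    lengths thus reduce to one step. *)
Lemma block_kl1_le l s : (0 < l)%N -> block_kl N M 1 s <= block_kl N M l s.
Proof.
case: l => // l _; rewrite -[l.+1]add1n block_kl_chain lerDl sumr_ge0 // => t _.
by rewrite mulr_ge0 ?block_kl_ge0 // divr_ge0 // ltW.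
Qed.

Hypotheses (N_nil : N [::] = 1) (M_nil : M [::] = 1).

Definition kl_level n := \sum_(s <- strs n) ln (N s / M s) * N s.

Lemma kl_level_block n : kl_level n = block_kl N M n [::].
Proof.
by apply: eq_bigr => s _; rewrite N_nil M_nil !divr1 mulrC.
Qed.

Lemma kl_levelD n l :
  kl_level (n + l) - kl_level n = \sum_(s <- strs n) N s * block_kl N M l s.
Proof.
rewrite !kl_level_block block_kl_chain addrAC subrr add0r.
by apply: eq_bigr => s _; rewrite N_nil divr1.
Qed.

Lemma kl_level0 : kl_level 0 = 0.
Proof.
by rewrite /kl_level big_seq1 N_nil M_nil divr1 ln1 mul0r.
Qed.

Lemma kl_level_mono n l : kl_level n <= kl_level (n + l).
Proof.
rewrite -subr_ge0 kl_levelD sumr_ge0 // => s _.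
by rewrite mulr_ge0 ?block_kl_ge0 // ltW.
Qed.

Lemma kl_level_ge0 n : 0 <= kl_level n.
Proof. by rewrite -kl_level0 -[n]add0n kl_level_mono. Qed.

Lemma sum_block_kl_le l K (B : R) : (forall n, kl_level n <= B) ->
  \sum_(n < K) \sum_(s <- strs n) N s * block_kl N M l s <= l%:R * B.
Proof.
move=> EB; under eq_bigr do rewrite -kl_levelD.
elim: l => [|l IH]; first by rewrite mul0r big1 // => n _; rewrite addn0 subrr.
(* One more bit per block adds one-step increments, which telescope over [n] to the level K + l
   minus the level l, at most [B]; hence the factor [l]. *)
rewrite -natr1 mulrDl mul1r (eq_bigr (fun n :
  'I_K => (kl_level (n + l) - kl_level n)
  + (kl_level (n.+1 + l) - kl_level (n + l)))); last first.
  by move=> n _; rewrite addnS addSn [RHS]addrC subrKA.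
rewrite big_split lerD //= -(big_mkord predT (fun n =>
  kl_level (n.+1 + l) - kl_level (n + l))).
rewrite (telescope_sumr (fun n => kl_level (n + l))) //.
by have := kl_level_ge0 (0 + l); have := EB (K + l)%N; lra.
Qed.
End BlockKL.

(** * Tilted masses and their one-step divergence *)

Section Tilt.
Context (R : realType) (N : seq bool -> R) (V : pred (seq bool)) (i : bool).
Hypothesis N0 : forall s, 0 < N s.
Hypothesis N_rcons : forall s, N s = N (rcons s false) + N (rcons s true).
Hypothesis N_nil : N [::] = 1.

(* At the strings of [V], the conditional probability of the bit [i] is divided
   by four. *)
Definition tilt_ratio (s : seq bool) (b : bool) : R :=
  if V s then
    if b == i then 1 / 4 else (N (rcons s b) + 3 / 4 * N (rcons s i)) / N
      (rcons s b)
  else 1.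

(** The product of the ratios along [s] is written as the exponential of a sum of logarithms, to
    which the closure properties of computable reals apply directly. *)
Definition tilt (s : seq bool) : R :=
  N s * expR (\sum_(k < size s) ln (tilt_ratio (take k s) (nth false s k))).

Lemma tilt_ratio_gt0 s b : 0 < tilt_ratio s b.
Proof.
rewrite /tilt_ratio; case: ifP => // _; case: ifP => // _.
by rewrite divr_gt0 // addr_gt0 // mulr_gt0.
Qed.

Lemma tilt_rcons_ratio s b :
  tilt (rcons s b) = tilt s / N s * N (rcons s b) * tilt_ratio s b.
Proof.
rewrite /tilt size_rcons big_ord_recr /= nth_rcons ltnn eqxx.
rewrite -cats1 take_size_cat // expRD lnK ?posrE ?tilt_ratio_gt0 //.
rewrite (eq_bigr (fun k : 'I_(size s) =>
  ln (tilt_ratio (take k s) (nth false s k)))).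
  by field; exact: lt0r_neq0.
by move=> k _; rewrite nth_cat ltn_ord takel_cat // ltnW.
Qed.

Lemma tilt_gt0 s : 0 < tilt s.
Proof. by rewrite mulr_gt0 // expR_gt0. Qed.

Lemma tilt_nil : tilt [::] = 1.
Proof. by rewrite /tilt big_ord0 expR0 mulr1. Qed.

(** The three quarters taken from the bit [i] are handed to the other bit, so the two ratios have
    [N]-average 1. *)
Lemma tilt_rcons s : tilt s = tilt (rcons s false) + tilt (rcons s true).
Proof.
have n0 u : N u != 0 by exact: lt0r_neq0.
have e : N (rcons s false) * tilt_ratio s false + N
  (rcons s true) * tilt_ratio s true = N s.
  rewrite /tilt_ratio (N_rcons s); case: ifP => _; last by rewrite !mulr1.
  by case: i => /=; field; rewrite n0.
by rewrite !tilt_rcons_ratio -!mulrA -!mulrDr e mulVf ?mulr1.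
Qed.

Lemma block_kl_tilt s : block_kl N tilt 1 s =
  - (N (rcons s false) / N s * ln (tilt_ratio s false)
     + N (rcons s true) / N s * ln (tilt_ratio s true)).
Proof.
rewrite /block_kl big_strsS big_seq1 !cats1 opprD.
have h b : ln (N (rcons s b) / N s / (tilt (rcons s b) / tilt s)) = - ln
  (tilt_ratio s b).
  rewrite -lnV ?posrE ?tilt_ratio_gt0 // tilt_rcons_ratio; congr (ln _).
  by field; rewrite !lt0r_neq0 ?tilt_ratio_gt0 ?tilt_gt0.
by rewrite !h !mulrN.
Qed.

Lemma block_kl_tilt_out s : ~~ V s -> block_kl N tilt 1 s = 0.
Proof.
by move=> nV; rewrite block_kl_tilt /tilt_ratio (negbTE nV) ln1 !mulr0 addr0 oppr0.
Qed.

Lemma ln4_bounds : 1 <= ln (4 : R) <= 3.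
Proof.
apply/andP; split; last first.
  have -> : (4 : R) = 1 + 3 by lra.
  by apply: le_ln1Dx; lra.
have -> : (4 : R) = 2 * 2 by lra.
rewrite lnM ?posrE //.
by have := @ln_ge1BV R 2 ltac:(lra); lra.
Qed.

(** The divergence is pi ln 4 - pj ln r, where pj (r - 1) = 3/4 pi. With ln 4 >= 1 and ln r <= r - 1
    it is at least pi - 3/4 pi; with ln r >= 0 and pi <= 1 it is at most ln 4. *)
Lemma block_kl_tilt_in s : V s ->
  N (rcons s i) / N s / 4 <= block_kl N tilt 1 s <= 3.
Proof.
move=> Vs; rewrite block_kl_tilt /tilt_ratio Vs.
have [l4 u4] := andP ln4_bounds.
have lnq : ln (1 / 4 : R) = - ln 4 by rewrite div1r lnV ?posrE.
pose pi := N (rcons s i) / N s; pose pj := N (rcons s (~~ i)) / N s.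
pose r := (N (rcons s (~~ i)) + 3 / 4 * N (rcons s i)) / N (rcons s (~~ i)).
have n0 u : N u != 0 by exact: lt0r_neq0.
have pi0 : 0 < pi by rewrite divr_gt0.
have pj0 : 0 < pj by rewrite divr_gt0.
have pij : pi + pj = 1.
  rewrite /pi /pj -mulrDl -[RHS](divff (n0 s)); congr (_ / _).
  by rewrite (N_rcons s); case: i => //=; rewrite addrC.
have r1 : 1 <= r.
  by rewrite /r ler_pdivlMr // mul1r lerDl mulr_ge0 // ltW.
have rE : pj * (r - 1) = 3 / 4 * pi by rewrite /pj /pi /r; field; rewrite !n0.
have lr0 : 0 <= ln r by exact: ln_ge0.
have lr1 : ln r <= r - 1.
  have := @le_ln1Dx R (r - 1); rewrite addrCA subrr addr0; apply.
  by lra.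
have -> : - (N (rcons s false) / N s * ln (if false == i then 1 / 4
      else (N (rcons s false) + 3 / 4 * N (rcons s i)) / N (rcons s false))
    + N (rcons s true) / N s * ln (if true == i then 1 / 4
      else (N (rcons s true) + 3 / 4 * N (rcons s i)) / N (rcons s true)))
  = pi * ln 4 - pj * ln r.
  by rewrite /pi /pj /r; case: i => /=; rewrite lnq; ring.
rewrite -/pi; apply/andP; split.
  have h1 : pj * ln r <= 3 / 4 * pi by rewrite -rE ler_wpM2l // ltW.
  have h2 : pi * 1 <= pi * ln 4 by rewrite ler_wpM2l // ltW.
  by lra.
have h1 : 0 <= pj * ln r by rewrite mulr_ge0 // ltW.
have h2 : pi * ln 4 <= 1 * ln 4 by rewrite ler_wpM2r //; lra.
by lra.
Qed.

End Tilt.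

(** * Martin-Löf randomness implies summable divergences *)

Lemma nneseries_ltyP (R : realType) (f : nat -> R) : (forall n, 0 <= f n) ->
  (\sum_(0 <= n <oo) (f n)%:E < +oo)%E <->
  exists B, forall K, \sum_(n < K) f n <= B.
Proof.
move=> f0; have f0E n : (0 <= (f n)%:E)%E by rewrite lee_fin.
have part K : (\sum_(0 <= n < K) (f n)%:E = (\sum_(n < K) f n)%:E)%E.
  by rewrite sumEFin big_mkord.
split=> [fin|[B fB]].
  exists (fine (\sum_(0 <= n <oo) (f n)%:E)%E) => K.
  rewrite -lee_fin fineK; last first.
    by rewrite ge0_fin_numE // nneseries_ge0.
  by rewrite -part; exact: nneseries_lim_ge.
apply: (@le_lt_trans _ _ B%:E); last exact: ltry.
apply: lime_le; first exact: is_cvg_nneseries.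
by near=> K; rewrite part lee_fin.
Unshelve. all: by end_near. Qed.

Lemma measure_bigcup_le (R : realType) (nu : probability cantor R)
    (A : nat -> set cantor) (B : \bar R) :
  (forall k, measurable (A k)) -> (forall k, A k `<=` A k.+1) ->
  (forall k, nu (A k) <= B)%E -> (nu (\bigcup_k A k) <= B)%E.
Proof.
move=> mA incA nuA.
have ndA : nondecreasing_seq A.
  by apply/nondecreasing_seqP => k; apply/subsetPset; exact: incA.
have cv := nondecreasing_cvg_mu (mu := nu) mA (bigcupT_measurable _ mA) ndA.
rewrite -(cvg_lim _ cv) //; apply: lime_le; first by apply/cvg_ex; eexists;
  exact: cv.
exact: nearW.
Qed.

Lemma take_mkseq T (f : nat -> T) j k : (j <= k)%N ->
  take j (mkseq f k) = mkseq f j.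
Proof. by move=> jk; rewrite /mkseq -map_take take_iota (minn_idPl jk). Qed.

Lemma size_strs n : size (strs n) = (2 ^ n)%N.
Proof.
by elim: n => [//|n IH] /=; rewrite size_cat !size_map IH expnS mul2n -addnn.
Qed.

Lemma computableR_bigseq (R : realType) (A : codeType) (I : Type) (r : seq I)
    (F : I -> A -> R) :
  (forall i, computableR (F i)) -> computableR (fun a => \sum_(i <- r) F i a).
Proof.
move=> cF; elim: r => [|i r IH].
  have r0 : rval R (0, (0, 0))%N = 0 by rewrite /rval subrr mul0r.
  have c0 : computableR (fun _ : A => rval R (0, (0, 0))%N).
    by apply: computableR_rval; computability.
  by apply: computableR_ext c0 => a; rewrite big_nil.
by apply: computableR_ext (computableR_add (cF i) IH) => a; rewrite big_cons.
Qed.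

Lemma computableR_block_kl (R : realType) (N M : seq bool -> R) l :
  (forall s, 0 < N s) -> (forall s, 0 < M s) ->
  computableR (A := str_codeType) N -> computableR (A := str_codeType) M ->
  computableR (A := str_codeType) (block_kl N M l).
Proof.
move=> N0 M0 cN cM; apply: computableR_bigseq => t.
have ct : computable (fun s : str_codeType => s ++ t) by computability.
have cr (L : seq bool -> R) : (forall s, 0 < L s) ->
    computableR (A := str_codeType) L ->
    computableR (fun s : str_codeType => L (s ++ t) / L s).
  by move=> L0 cL; apply: computableR_div_pos => //; exact: computableR_comp cL ct.
apply: computableR_mul; [by move=> s; rewrite divr_gt0|exact: cr|].
apply: computableR_ln; first by move=> s; rewrite !divr_gt0.
by apply: computableR_div_pos; try (by move=> s; rewrite divr_gt0); exact: cr.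
Qed.

Section Mass.
Context (R : realType) (nu : probability cantor R).

Lemma computableR_mass : computable_measure nu ->
  computableR (A := str_codeType) (mass nu).
Proof. exact: (@computableR_of R str_codeType). Qed.

Lemma sum_mass_strs n : \sum_(s <- strs n) mass nu s = 1.
Proof.
by rewrite -(mass_nil nu) -(sum_strs_cat n [::] (@mass_rcons R nu)).
Qed.

(** Otherwise the 2^(n+1) strings of length n + 1 would have total mass at least 2. *)
Lemma small_cylinder n : exists s, mass nu s < 2 ^- n.
Proof.
apply: contrapT => /forallNP h.
have : \sum_(s <- strs n.+1) (2 ^- n : R) <= \sum_(s <- strs n.+1) mass nu s.
  by apply: ler_sum => s _; rewrite leNgt; apply/negP; exact: h.
rewrite sum_mass_strs big_const_seq count_predT size_strs iter_addr addr0.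
rewrite -[_ *+ (2 ^ _)]mulr_natr natrX exprS mulrCA mulVf ?mulr1 ?expf_neq0 //.
by rewrite -[X in _ <= X]/(1%:R) ler_nat.
Qed.

Lemma kl_sup_level (mu : probability cantor R) :
  kl_sup nu mu = ereal_sup (range (fun n => (kl_level (mass nu) (mass mu) n)%:E)).
Proof.
congr ereal_sup; apply/seteqP; split=> _ [n _ <-]; exists n => //.
  by rewrite (expectation_strs nu n (fun s => ln (mass nu s / mass mu s))).
by rewrite (expectation_strs nu n (fun s => ln (mass nu s / mass mu s))).
Qed.

End Mass.

(* Any sigma1 sequence of sets of strings can be enumerated; the sets need not
   be nonempty, so each one is padded with a cylinder of small measure. *)
Lemma ML_test_of_sigma1 (R : realType) (nu : probability cantor R)
    (G : nat * seq bool -> Prop) : computable_measure nu ->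
  sigma1 (A := pair_codeType nat_codeType str_codeType) G ->
  (forall n, (nu (\bigcup_(s in [set s | G (n, s)]) cyl s) <= (2 ^- n.+1)%:E)%E) ->
  exists2 s, ML_test nu s &
    forall n, \bigcup_(t in [set t | G (n, t)]) cyl t `<=` open_of (s n).
Proof.
move=> cnu [p cp pG] nuG.
have cN := computableR_mass cnu.
have [pad cpad padP] : exists2 pad : nat -> str_codeType,
    computable pad & forall n, mass nu (pad n) < 2 ^- n.+1.
  apply: (@sigma1_choice nat_codeType str_codeType
      (fun z => mass nu z.2 < 2 ^- z.1.+1)); last first.
    by move=> n; have [s sn] := small_cylinder nu n.+1; exists s.
  have ch : computable (fun z : nat * str_codeType => rhalf z.1.+1).
    by apply: computable_rhalf; computability.
  have cs : computable (fun z : nat * str_codeType => z.2) by computability.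
  have [lo _] := computableR_sub (computableR_rval R ch) (computableR_comp cN cs).
  have cz : computable (fun z : nat * str_codeType => (z, (0, (0, 0))%N : ratcode)).
    by computability.
  apply: sigma1_ext (sigma1_comp lo cz) => z /=.
  by rewrite rval_rhalf /rval /= subrr mul0r subr_gt0.
(* The index [m] codes a string and a stage; the string is output if the stage certifies it, and the
   padding otherwise. The set and its padding each take half of the allowed 2^-n. *)
pose s (n m : nat) : seq bool :=
  if p ((n, dec1 str_codeType nat_codeType m), dec2 str_codeType nat_codeType m)
  then dec1 str_codeType nat_codeType m else pad n.
have openG n : open_of (s n) `<=`
    (\bigcup_(t in [set t | G (n, t)]) cyl t) `|` cyl (pad n).
  move=> w [m _]; rewrite /s; case: ifP => [pm|_]; last by right.
  by left; eexists; last eassumption; apply/pG; eexists; exact: pm.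
exists s; last first.
  move=> n w [t /pG[k pk] tw]; exists (enc (t, k)) => //.
  by rewrite /s dec1K dec2K pk.
split.
  have cd : computable (fun z : nat * nat => dec z.2 : str_codeType * nat).
    by apply: computable_dec; computability.
  have c1 : computable (fun z : nat * nat => dec1 str_codeType nat_codeType z.2).
    exact: computable_fst cd.
  have c2 : computable (fun z : nat * nat => dec2 str_codeType nat_codeType z.2).
    exact: computable_snd cd.
  have cs : computable (fun z : nat * nat => s z.1 z.2 : str_codeType).
    apply: computable_if => //; last by apply: (computable_comp cpad);
      computability.
    by apply: (computable_comp cp); computability.
  exact: (computable_recursive2 (computable_str_code cs)).
move=> n; have mG : measurable (\bigcup_(t in [set t | G (n, t)]) cyl t).
  rewrite (_ : \bigcup_(_ in _) _ =
      \bigcup_(i in [set i | G (n, str_decode i)]) cyl (str_decode i)).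
    by apply: bigcup_measurable => i _; exact: measurable_cyl.
  apply/seteqP; split=> w [t /= Gt tw]; last by exists (str_decode t).
  by exists (str_code t); rewrite /= str_codeK.
apply: (@le_trans _ _ (nu ((\bigcup_(t in [set t | G (n, t)]) cyl t) `|` cyl
  (pad n)))).
  apply: le_measure; rewrite ?inE //.
    by apply: bigcup_measurable => m _; exact: measurable_cyl.
  by apply: measurableU => //; exact: measurable_cyl.
apply: (le_trans (measureU2 _ _ _)) => //; first exact: measurable_cyl.
have -> : (2 ^- n)%:E = ((2 ^- n.+1)%:E + (2 ^- n.+1)%:E)%E :> \bar R.
  rewrite -EFinD; congr (_%:E); rewrite exprS invfM -mulrDl.
  by rewrite [_ + _](_ : _ = 1) ?mul1r //; lra.
by apply: leeD; [exact: nuG|rewrite [leLHS](nu_cyl nu (pad n)) lee_fin ltW].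
Qed.

Lemma MLR_sub_MR1 (R : realType) (nu : probability cantor R) l :
  computable_measure nu -> full_support nu -> MLR nu `<=` MR1 (@ll_kl R) nu l.
Proof.
move=> cnu fnu w wMLR mu cmu fmu klmu.
pose N := mass nu; pose M := mass mu.
pose D := block_kl N M l.
have D0 s : 0 <= D s.
  by apply: block_kl_ge0 => // t; [exact: mass_rcons|exact: mass_rcons].
have cD : computableR (A := str_codeType) D.
  by apply: computableR_block_kl => //; exact: computableR_mass.
pose B := fine (kl_sup nu mu).
have klB n : kl_level N M n <= B.
  rewrite -lee_fin fineK // kl_sup_level; apply: ereal_sup_ubound.
  by exists n.
pose S s := \sum_(k < (size s).+1) D (take k s).
have cS : computableR (A := str_codeType) S.
  apply: (@computableR_sum _ _ (fun z : str_codeType * nat => D (take z.2 z.1))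
    (fun s => (size s).+1)); last by computability.
  by apply: (computableR_comp (f := fun z : str_codeType * nat => take z.2 z.1) cD);
    computability.
have SE v k : S (mkseq v k) = \sum_(j < k.+1) D (mkseq v j).
  rewrite /S size_mkseq; apply: eq_bigr => j _; rewrite take_mkseq //.
  by rewrite -ltnS.
(* The divergence at a prefix depends on that prefix alone, and the masses of its extensions add up,
   so the integral of [S] becomes a sum over levels. *)
have intS k : \sum_(s <- strs k) N s * S s <= l%:R * B.
  rewrite (_ : \sum_(s <- _) _ = \sum_(j < k.+1) \sum_(s <- strs j) N s * D s).
    by apply: sum_block_kl_le => //; exact: mass_rcons || exact: mass_nil.
  transitivity (\sum_(s <- strs k) \sum_(j < k.+1) N s * D (take j s)).
    apply: eq_big_seq => s; rewrite mem_strs => /eqP sk.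
    by rewrite /S sk mulr_sumr.
  rewrite exchange_big; apply: eq_bigr => j _ /=.
  move: (nat_of_ord j) (leq_ord j) => i ik.
  rewrite -(subnKC ik) big_strs_cat; apply: eq_big_seq => s.
  rewrite mem_strs => /eqP sj.
  rewrite (eq_bigr (fun t => N (s ++ t) * D s)); last first.
    by move=> t _; rewrite take_size_cat.
  by rewrite -mulr_suml sum_strs_cat //; exact: mass_rcons.
(* Only the integer [c0] enters the test, so [B] may fail to be computable. Markov's inequality at
   the threshold [c0 * 2 ^ n.+1] yields 2^-(n+1), the bound asked by [ML_test_of_sigma1]. *)
pose c0 := (Num.truncn (l%:R * B)).+1.
have c0B : l%:R * B < c0%:R by exact: truncnS_gt.
pose c (n : nat) := (c0 * 2 ^ n.+1)%N.
have c_gt0 n : 0 < (c n)%:R :> R by rewrite ltr0n muln_gt0 expn_gt0.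
pose G (z : nat * seq bool) := (c z.1)%:R < S z.2.
have sG : sigma1 (A := pair_codeType nat_codeType str_codeType) G.
  have [lo _] := cS.
  have cf : computable (fun z : nat * str_codeType => (z.2, (c z.1, (0, 0))%N :
    ratcode)).
    by rewrite /c; computability.
  apply: sigma1_ext (sigma1_comp lo cf) => z /=.
  by rewrite /rval /= subr0 divr1.
have GE n : \bigcup_(s in [set s | G (n, s)]) cyl s =
    \bigcup_k [set v : cantor | (c n)%:R < S (mkseq v k)].
  apply/seteqP; split=> [v [s Gs sv]|v [k _ /= Gk]].
    by exists (size s) => //=; rewrite sv.
  by exists (mkseq v k) => //; exact: cyl_mkseq.
have [s sML Gs] : exists2 s, ML_test nu s &
    forall n, \bigcup_(t in [set t | G (n, t)]) cyl t `<=` open_of (s n).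
  apply: (@ML_test_of_sigma1 R nu G) => // n; rewrite GE; apply: measure_bigcup_le.
  - by move=> k; exact: (@measurable_level k [set s | (c n)%:R < S s]).
  - move=> k v /= /lt_le_trans; apply.
    by rewrite !SE [leRHS]big_ord_recr lerDl.
  - move=> k; rewrite (measure_level nu k (fun s => (c n)%:R < S s)) lee_fin.
    have S0 s : 0 <= S s by apply: sumr_ge0.
    apply: (@le_trans _ _ (\sum_(s <- strs k) N s * S s / (c n)%:R)).
      apply: ler_sum => t _; have [ct|_] := ltP (c n)%:R (S t).
        rewrite mul1r -mulrA ler_peMr ?(ltW (fnu t)) //.
        by rewrite ler_pdivlMr // mul1r ltW.
      by rewrite mul0r divr_ge0 // ?mulr_ge0 // ?ltW.
    rewrite -mulr_suml ler_pdivrMr // natrM natrX mulrCA mulVf ?mulr1 ?expf_neq0 //.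
    exact: le_trans (intS k) (ltW c0B).
under eq_eseriesr do rewrite KL_F_block //.
apply/nneseries_ltyP => //; apply: contrapT => /forallNP unb.
apply: (wMLR s sML) => n _; apply: Gs; rewrite GE.
have /existsNP[K /negP] := unb (c n)%:R; rewrite -ltNge => cK.
(* [S] at a string of length [K] has K + 1 terms, hence the shift. *)
case: K cK => [|K cK]; first by rewrite big_ord0 ltNge ltW.
by exists K => //=; rewrite SE.
Qed.

(** * Hitting times of a test *)

Section Hit.
Variable s : nat -> nat -> seq bool.

(* A decidable approximation of the [n]-th open set of a test: [t] is required
   to be longer than the indices of the enumerated strings that are searched. *)
Definition hit (n : nat) (t : seq bool) : bool :=
  (n < size t)%N && has (fun m => prefix (s n m) t) (iota 0 (size t).+1).

(** The bound on [n] loses nothing, as [hit n t] already puts [n] below the size of [t]. A string at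
    which several sets are entered counts once. *)
Definition entry (t : seq bool) : bool := (0 < size t)%N &&
  has (fun n => hit n t && ~~ hit n (take (size t).-1 t)) (iota 0 (size t)).

Lemma hit_take n j t : hit n (take j t) -> hit n t.
Proof.
have sjt : (size (take j t) <= size t)%N by rewrite size_take_min geq_minr.
move=> /andP[nt /hasP[m mt pm]]; apply/andP; split; first exact: leq_trans sjt.
apply/hasP; exists m; last by apply: (prefix_trans pm); exact: prefix_take.
by move: mt; rewrite !mem_iota !add0n => /leq_trans; apply.
Qed.

Lemma open_of_hit n : open_of (s n) = \bigcup_k [set w | hit n (mkseq w k)].
Proof.
apply/seteqP; split=> [w [m _ mw]|w [k _ /= /andP[_ /hasP[m _ pm]]]]; last first.
  exists m => //; move: (pm); rewrite (cyl_prefix (cyl_mkseq w k)).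
    by move/eqP.
  exact: size_prefix.
(* The three summands meet the length requirement, reach the index [m], and make the prefix contain
   [s n m]. *)
pose k := (n.+1 + m + size (s n m))%N; exists k => //=.
rewrite /hit size_mkseq; apply/andP; split; first by rewrite /k; lia.
apply/hasP; exists m; first by rewrite mem_iota add0n /k /=; lia.
have pk : (size (s n m) <= size (mkseq w k))%N by rewrite size_mkseq /k; lia.
by rewrite (cyl_prefix (cyl_mkseq w k) pk); apply/eqP.
Qed.

Lemma computable_hit : computable_strings s ->
  computable (fun z : nat * str_codeType => hit z.1 z.2).
Proof.
move=> cs.
have c : computable (fun z : nat * nat => s z.1 z.2 : str_codeType).
  apply: computable_of_enc.
  have c1 : computable (fun z : nat * nat => z.1) by computability.
  have c2 : computable (fun z : nat * nat => z.2) by computability.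
  apply: computable_ext (recursive2_computable cs c1 c2) => z.
  by rewrite !(tnth_nth 0%N).
apply: computable_and; first by computability.
apply: (@computable_has _ (fun z => prefix (s z.1.1 z.2) z.1.2));
  last by computability.
apply: computable_prefix; last by computability.
by apply: (computable_comp2 (f := s) c); computability.
Qed.

Lemma computable_entry : computable_strings s ->
  computable (fun t : str_codeType => entry t).
Proof.
move=> /computable_hit ch; apply: computable_and; first by computability.
apply: (@computable_has _ (fun z =>
  hit z.2 z.1 && ~~ hit z.2 (take (size z.1).-1 z.1)));
  last by computability.
by apply: computable_and; [|apply: computable_not];
  apply: (computable_comp2 (f := hit) ch); computability.
Qed.

(** The first time that [w] hits the [k]-th set is an entry, and it occurs beyond length [k] by the
    length requirement in [hit]. *)
Lemma entries_unbounded w k : (\bigcap_n open_of (s n)) w ->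
  exists2 j, (k < j)%N & entry (mkseq w j).
Proof.
move=> /(_ k Logic.I); rewrite open_of_hit => -[j0 _ /= hj0].
have ex : exists j, hit k (mkseq w j) by exists j0.
have [j hj jmin] := ex_minnP ex.
have kj : (k < j)%N by move: hj => /andP[]; rewrite size_mkseq.
exists j => //; rewrite /entry size_mkseq (leq_trans _ kj) //=.
apply/hasP; exists k; first by rewrite mem_iota.
rewrite hj /= take_mkseq ?leq_pred //; apply/negP => /jmin.
by case: (j) kj => // j' _ /=; rewrite ltnn.
Qed.

(** * Mass of the strings that have hit a test *)

Section Hitting.
Context (R : realType) (nu : probability cantor R).
Local Notation N := (mass nu).
Hypothesis nus : forall n, (nu (open_of (s n)) <= (2 ^- n)%:E)%E.

Definition hit_mass n j : R := \sum_(t <- strs j) (hit n t)%:R * N t.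

Definition test_mass n : R := fine (nu (open_of (s n))).

Lemma mass_ge0 t : 0 <= N t.
Proof. by rewrite /mass fine_ge0. Qed.

Lemma measurable_open_of (u : nat -> seq bool) : measurable (open_of u).
Proof. by apply: bigcup_measurable => m _; exact: measurable_cyl. Qed.

Lemma test_massE n : nu (open_of (s n)) = (test_mass n)%:E.
Proof. by rewrite /test_mass fineK // fin_num_measure //;
  exact: measurable_open_of. Qed.

Lemma hit_massE n j : nu [set w | hit n (mkseq w j)] = (hit_mass n j)%:E.
Proof. exact: measure_level. Qed.

Lemma hit_massS n j : hit_mass n j.+1 - hit_mass n j =
  \sum_(t <- strs j.+1) ((hit n t)%:R - (hit n (take j t))%:R) * N t.
Proof.
have -> : hit_mass n j = \sum_(t <- strs j.+1) (hit n (take j t))%:R * N t.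
  rewrite big_strs_rcons; apply: eq_big_seq => t; rewrite mem_strs => /eqP tj.
  by rewrite -!cats1 -!tj !take_size_cat // -mulrDr !cats1 -mass_rcons.
by rewrite -sumrB; apply: eq_bigr => t _; rewrite mulrBl.
Qed.

Lemma hit_mass_le_S n j : hit_mass n j <= hit_mass n j.+1.
Proof.
rewrite -subr_ge0 hit_massS sumr_ge0 // => t _; rewrite mulr_ge0 ?mass_ge0 //.
rewrite subr_ge0 ler_nat; have := @hit_take n j t.
by case: (hit n (take j t)) => // ->.
Qed.

Lemma hit_mass_mono n : {homo hit_mass n : j k / (j <= k)%N >-> j <= k}.
Proof. exact/nondecreasing_seqP/hit_mass_le_S. Qed.

Lemma hit_mass0 n : hit_mass n 0 = 0.
Proof. by rewrite /hit_mass big_seq1 /hit ltn0 mul0r. Qed.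

Lemma hit_mass_cvg n : hit_mass n j @[j --> \oo] --> test_mass n.
Proof.
pose A j := [set w : cantor | hit n (mkseq w j)].
have mA j : measurable (A j) by exact: (@measurable_level j [set t | hit n t]).
have ndA : nondecreasing_seq A.
  apply/nondecreasing_seqP => j; apply/subsetPset => w /=; rewrite /A /=.
  by rewrite -(take_mkseq w (leqnSn j)); exact: hit_take.
have h : nu \o A @ \oo --> (test_mass n)%:E.
  rewrite -test_massE open_of_hit.
  exact: nondecreasing_cvg_mu mA (bigcupT_measurable _ mA) ndA.
have -> : hit_mass n = fine \o (nu \o A).
  by apply/funext => j /=; rewrite /A hit_massE.
exact: fine_cvg.
Qed.

Lemma hit_mass_le n j : hit_mass n j <= test_mass n.
Proof.
rewrite -lee_fin -hit_massE -test_massE; apply: le_measure; rewrite ?inE.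
- exact: (@measurable_level j [set t | hit n t]).
- exact: measurable_open_of.
- by rewrite open_of_hit => w hw; exists j.
Qed.

Lemma test_mass_le n : test_mass n <= 2 ^- n.
Proof. by rewrite -lee_fin -test_massE. Qed.

(** Union bound: every entry of length j + 1 is newly hit for some n <= j. *)
Lemma entry_mass_le j : \sum_(t <- strs j.+1) (entry t)%:R * N t <=
  \sum_(n < j.+1) (hit_mass n j.+1 - hit_mass n j).
Proof.
under [leRHS]eq_bigr do rewrite hit_massS.
rewrite exchange_big [leLHS]big_seq [leRHS]big_seq; apply: ler_sum => t.
rewrite mem_strs => /eqP tj; rewrite -mulr_suml ler_wpM2r ?mass_ge0 //.
have d0 n : 0 <= (hit n t)%:R - (hit n (take j t))%:R :> R.
  rewrite subr_ge0 ler_nat; have := @hit_take n j t.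
  by case: (hit n (take j t)) => // ->.
have [/andP[_ /hasP[n]]|_] := boolP (entry t); last exact: sumr_ge0.
rewrite mem_iota add0n tj /= => nj /andP[hn /negbTE hn'].
rewrite (bigD1 (Ordinal nj)) //= hn hn' subr0 lerDl.
exact: sumr_ge0.
Qed.

End Hitting.
End Hit.

(** * The tilted measure of a test *)

Lemma str_decode_cons (b : bool) c : str_decode (c.*2 + b).+1 = b :: str_decode c.
Proof. by apply: str_code_inj; rewrite str_decodeK /= str_decodeK. Qed.

Lemma big_ord_double (R : realType) n (G : nat -> R) :
  \sum_(i < n.*2) G i = \sum_(i < n) (G i.*2 + G i.*2.+1).
Proof.
elim: n => [|n IH]; first by rewrite !big_ord0.
by rewrite doubleS !big_ord_recr /= IH addrA.
Qed.

(** The strings of length [n] are those with codes from 2^n - 1 to 2^(n+1) - 2. A sum over them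
    becomes a sum over an initial segment of [nat], where [computableR_sum] applies. *)
Lemma big_strs_code (R : realType) n (F : seq bool -> R) :
  \sum_(t <- strs n) F t = \sum_(c < 2 ^ n) F (str_decode (c + (2 ^ n - 1))).
Proof.
elim: n F => [|n IH] F; first by rewrite big_seq1 big_ord1.
have p0 : (0 < 2 ^ n)%N by rewrite expn_gt0.
rewrite big_strsS IH expnS mul2n.
rewrite (big_ord_double _ (fun c => F (str_decode (c + ((2 ^ n).*2 - 1))))).
apply: eq_bigr => c _; rewrite -!str_decode_cons.
by congr (F (str_decode _) + F (str_decode _)); lia.
Qed.

Lemma computableR_strs (R : realType) (A : codeType) (x : A * str_codeType -> R)
    (k : A -> nat) : computableR x -> computable k ->
  computableR (fun a => \sum_(t <- strs (k a)) x (a, t)).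
Proof.
move=> cx ck.
have cd : computable (fun z : A * nat => str_decode (z.2 + (2 ^ k z.1 - 1)) :
  str_codeType).
  by computability.
have cz : computable (fun z : A * nat =>
    (z.1, str_decode (z.2 + (2 ^ k z.1 - 1)) : str_codeType)) by computability.
have c2k : computable (fun a => 2 ^ k a)%N by computability.
apply: computableR_ext (computableR_sum (computableR_comp cx cz) c2k) => a /=.
by rewrite big_strs_code.
Qed.

Lemma computable_rcons (A : codeType) (t : A -> str_codeType) (b : A -> bool) :
  computable t -> computable b -> computable (fun a => rcons (t a) (b a) :
    str_codeType).
Proof.
move=> ct cb.
have c : computable (fun a => t a ++ (if b a then [:: true] else [:: false]) :
  str_codeType).
  by computability.
by apply: computable_ext c => a; rewrite -cats1; case: (b a).
Qed.

Section ComputableTilt.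
Context (R : realType) (N : seq bool -> R) (V : pred (seq bool)) (i : bool).
Hypothesis N0 : forall s, 0 < N s.
Hypothesis cN : computableR (A := str_codeType) N.
Hypothesis cV : computable (fun s : str_codeType => V s).

Lemma computableR_tilt_ratio :
  computableR (fun z : str_codeType * bool => tilt_ratio N V i z.1 z.2).
Proof.
have rv p q : computableR (fun _ : str_codeType * bool => rval R (p, (0, q))%N).
  by apply: computableR_rval; computability.
have rvE p q : rval R (p, (0, q))%N = p%:R / q.+1%:R by rewrite /rval /= subr0.
have cVz : computable (fun z : str_codeType * bool => V z.1) by computability.
have cb : computable (fun z : str_codeType * bool => z.2 == i) by computability.
have c1 : computable (fun z : str_codeType * bool => rcons z.1 z.2 : str_codeType).
  by apply: computable_rcons; computability.
have c2 : computable (fun z : str_codeType * bool => rcons z.1 i : str_codeType).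
  by apply: computable_rcons; computability.
have cN1 := computableR_comp cN c1; have cN2 := computableR_comp cN c2.
apply: computableR_if => //; last first.
  by apply: computableR_ext (rv 1 0)%N => z; rewrite rvE divr1.
apply: computableR_if => //.
  by apply: computableR_ext (rv 1 3)%N => z; rewrite rvE.
have c34 : computableR (fun z : str_codeType * bool => 3 / 4 * N (rcons z.1 i)).
  apply: computableR_ext (computableR_mul_pos _ _ (rv 3 3)%N cN2) => [z|z|z] //.
    by rewrite rvE.
  by rewrite rvE divr_gt0.
apply: computableR_div_pos => //; last exact: computableR_add.
by move=> z; rewrite addr_gt0 // mulr_gt0.
Qed.

Lemma computableR_tilt : computableR (A := str_codeType) (tilt N V i).
Proof.
apply: computableR_mul_pos => //; first by move=> s; exact: expR_gt0.
apply: computableR_exp.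
apply: (@computableR_sum _ str_codeType
  (fun z : str_codeType * nat => ln (tilt_ratio N V i (take z.2 z.1)
    (nth false z.1 z.2)))
  size); last by computability.
have cz : computable (fun z : str_codeType * nat =>
    (take z.2 z.1 : str_codeType, nth false z.1 z.2)) by computability.
apply: computableR_ln; first by move=> z; exact: tilt_ratio_gt0.
exact: (computableR_comp computableR_tilt_ratio cz).
Qed.

End ComputableTilt.

Lemma computableR_kl_level (R : realType) (N M : seq bool -> R) :
  (forall s, 0 < N s) -> (forall s, 0 < M s) ->
  computableR (A := str_codeType) N -> computableR (A := str_codeType) M ->
  computableR (kl_level N M).
Proof.
move=> N0 M0 cN cM.
have c2 : computable (fun z : nat * str_codeType => z.2) by computability.
have cN2 := computableR_comp cN c2; have cM2 := computableR_comp cM c2.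
have cx : computableR (fun z : nat * str_codeType => N z.2 * ln (N z.2 / M z.2)).
  apply: computableR_mul => //; apply: computableR_ln.
    by move=> z; rewrite divr_gt0.
  exact: computableR_div_pos.
apply: computableR_ext (computableR_strs cx computable_id) => n.
by apply: eq_bigr => s _; rewrite mulrC.
Qed.

Lemma geometric_sum_le (R : realType) K : \sum_(n < K) (2 ^- n : R) <= 2.
Proof.
suff -> : \sum_(n < K) (2 ^- n : R) = 2 - 2 * 2 ^- K.
  by rewrite lerBlDr lerDl mulr_ge0 // invr_ge0 exprn_ge0.
elim: K => [|K IH]; first by rewrite big_ord0 expr0 invr1 mulr1 subrr.
rewrite big_ord_recr /= IH exprS invfM mulrA divff // mul1r.
by lra.
Qed.

Lemma sum_dyadic_tail_le (R : realType) (d : nat -> R) n0 K :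
  (forall n, 0 <= d n <= 2 ^- n) ->
  \sum_(n < K) d n <= \sum_(n < n0) d n + 2 * 2 ^- n0.
Proof.
move=> dP; have d0 n : 0 <= d n by have /andP[] := dP n.
(* Lengthening the sum to n0 + K terms avoids comparing [K] with [n0]. *)
apply: (@le_trans _ _ (\sum_(n < n0 + K) d n)).
  by rewrite addnC big_split_ord /= lerDl sumr_ge0.
rewrite big_split_ord /= lerD2l.
have p0 : 0 <= (2 ^- n0 : R) by rewrite invr_ge0 exprn_ge0.
apply: le_trans (ler_wpM2r p0 (@geometric_sum_le R K)).
rewrite mulr_suml; apply: ler_sum => n _.
have /andP[_ dn] := dP (n0 + n)%N.
by apply: le_trans dn _; rewrite exprD invfM mulrC.
Qed.

(** * Finiteness and computability of the divergence of a tilted measure *)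

Section TestTilt.
Context (R : realType) (nu : probability cantor R).
Context (s : nat -> nat -> seq bool) (i : bool).
Hypotheses (cnu : computable_measure nu) (fnu : full_support nu).
Hypothesis cs : computable_strings s.
Hypothesis nus : forall n, (nu (open_of (s n)) <= (2 ^- n)%:E)%E.
Local Notation N := (mass nu).
Local Notation M := (tilt N (entry s) i).
Local Notation E := (kl_level N M).
Local Notation h := (hit_mass s nu).
Local Notation u := (test_mass s nu).

Let N_rcons := @mass_rcons R nu.
Let N_nil := @mass_nil R nu.
Let M0 : forall t, 0 < M t := tilt_gt0 (entry s) i fnu.
Let M_rcons : forall t, M t = M (rcons t false) + M (rcons t true) :=
  tilt_rcons (entry s) i fnu N_rcons.
Let M_nil : M [::] = 1 := tilt_nil (entry s) i N_nil.

Lemma kl_level_step j : E j.+1 - E j <= 3 * \sum_(t <- strs j) (entry s t)%:R * N t.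
Proof.
rewrite -addn1 kl_levelD // mulr_sumr; apply: ler_sum => t _.
have [et|net] := boolP (entry s t).
  have /andP[_ h3] := block_kl_tilt_in i fnu N_rcons et.
  by rewrite mul1r mulrC ler_wpM2r // ltW.
by rewrite block_kl_tilt_out // mulr0 mul0r mulr0.
Qed.

(** The growth from level k + 1 to k + 2 is paid by the entries of length k + 1, hence by the mass
    newly hit there; these increments of [h] telescope. The range of [n] grows with the level, and
    the added terms are nonnegative. *)
Lemma kl_level_tail j K : (j <= K)%N ->
  E K.+1 - E j.+1 <= 3 * \sum_(n < K.+1) (h n K - h n j).
Proof.
move=> /subnK <-; elim: (K - j)%N => [|d IH].
  by rewrite add0n subrr mulr_ge0 // sumr_ge0 // => n _; rewrite subrr.
rewrite addSn; set k := (d + j)%N in IH *.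
have step := kl_level_step k.+1; have entry_le := entry_mass_le s nu k.
have -> : \sum_(n < k.+2) (h n k.+1 - h n j) =
    \sum_(n < k.+2) (h n k.+1 - h n k) + \sum_(n < k.+2) (h n k - h n j).
  by rewrite -big_split; apply: eq_bigr => n _ /=; rewrite subrKA.
have jk : (j <= k)%N by rewrite leq_addl.
have a1 : \sum_(n < k.+1) (h n k.+1 - h n k) <= \sum_(n < k.+2) (h n k.+1 - h n k).
  by rewrite [leRHS]big_ord_recr lerDl subr_ge0 hit_mass_mono.
have a2 : \sum_(n < k.+1) (h n k - h n j) <= \sum_(n < k.+2) (h n k - h n j).
  by rewrite [leRHS]big_ord_recr lerDl subr_ge0 hit_mass_mono.
by lra.
Qed.

(** A bound for all levels: the level j + 1, plus three times the mass still to be hit, exact for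
    the first [n0] sets and estimated by a geometric tail for the others. It is computable when the
    measures of the sets are. *)
Definition kl_upper j n0 := E j.+1 + 3 * (\sum_(n < n0)
  (u n - h n j) + 2 * 2 ^- n0).

Lemma kl_level_le_upper j n0 K : E K <= kl_upper j n0.
Proof.
have mono a b : (a <= b)%N -> E a <= E b.
  by move=> /subnKC <-; exact: kl_level_mono.
apply: (@le_trans _ _ (E (j + K).+1)); first by apply: mono;
  rewrite leqW // leq_addl.
have := kl_level_tail (leq_addr K j); rewrite lerBlDl => /le_trans; apply.
rewrite /kl_upper lerD2l ler_wpM2l //.
apply: le_trans (sum_dyadic_tail_le (d := fun n => u n - h n j) n0 (j + K).+1 _).
  by apply: ler_sum => n _; rewrite lerD2r hit_mass_le.
move=> n; rewrite subr_ge0 hit_mass_le /=.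
apply: le_trans (test_mass_le nus n); rewrite gerBl.
by rewrite -(hit_mass0 s nu n) hit_mass_mono.
Qed.

Lemma hit_mass_gap n0 eps : 0 < eps ->
  exists j, forall k, (j <= k)%N -> \sum_(n < n0) (u n - h n k) < eps.
Proof.
elim: n0 eps => [|n0 IH] eps eps0; first by exists 0 => k _; rewrite big_ord0.
have e0 : 0 < eps / 2 by rewrite divr_gt0.
have [j jP] := IH _ e0.
have [j' _ j'P] : \forall k \near \oo, `|u n0 - h n0 k| < eps / 2.
  by have /cvgrPdist_lt := @hit_mass_cvg s R nu n0; apply.
exists (maxn j j') => k; rewrite geq_max => /andP[jk j'k].
rewrite big_ord_recr /=; have := jP k jk.
have := j'P k j'k; rewrite /= => /(le_lt_trans (ler_norm _)).
by lra.
Qed.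

Lemma kl_upper_lt r q : (forall n, E n <= r) -> r < q ->
  exists j n0, kl_upper j n0 < q.
Proof.
move=> Er rq.
(* With eps the twelfth of the gap, the excess is below 3 (eps + 2 eps) = 9 eps. *)
have e0 : 0 < (q - r) / 12 by rewrite divr_gt0 // subr_gt0.
have [n0 n0P] := small_pow2 e0.
have [j jP] := hit_mass_gap n0 e0.
exists j, n0; have := jP j (leqnn j); have := Er j.+1; rewrite /kl_upper; lra.
Qed.

Lemma computableR_hit_mass : computableR (fun z : nat * nat => h z.1 z.2).
Proof.
have ch := computable_hit cs.
have c1 : computable (fun z : (nat * nat) * str_codeType => hit s z.1.1 z.2).
  by apply: (computable_comp2 (f := hit s) ch); computability.
have c2 : computable (fun z : (nat * nat) * str_codeType => z.2) by computability.
have c0 : computableR (fun _ : (nat * nat) * str_codeType => rval R (0, (0, 0))%N).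
  by apply: computableR_rval; computability.
have ck : computable (fun z : nat * nat => z.2) by computability.
have cx := computableR_if c1 (computableR_comp (computableR_mass cnu) c2) c0.
apply: computableR_ext (computableR_strs cx ck) => z /=.
apply: eq_bigr => t _; rewrite /rval subrr mul0r.
by case: (hit s z.1 t); rewrite ?mul1r ?mul0r.
Qed.

Lemma computableR_kl_upper : computableR u ->
  computableR (fun z : nat * nat => kl_upper z.1 z.2).
Proof.
move=> cu.
have cE : computableR E.
  apply: computableR_kl_level => //; first exact: computableR_mass.
  by apply: computableR_tilt => //; [exact: computableR_mass|exact:
    computable_entry].
have c1 : computable (fun z : nat * nat => z.1.+1) by computability.
have c2 : computable (fun z : nat * nat => z.2) by computability.
have c3 : computable (fun w : (nat * nat) * nat => w.2) by computability.
have c4 : computable (fun w : (nat * nat) * nat => (w.2, w.1.1)) by computability.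
have cd : computableR (fun w : (nat * nat) * nat => u w.2 - h w.2 w.1.1).
  by apply: computableR_sub (computableR_comp cu c3)
    (computableR_comp computableR_hit_mass c4).
have cg : computableR (fun z : nat * nat => rval R (2, (0, 2 ^ z.2 - 1))%N).
  by apply: computableR_rval; computability.
have ct : computableR (fun _ : nat * nat => rval R (3, (0, 0))%N).
  by apply: computableR_rval; computability.
have t0 (z : nat * nat) : 0 < rval R (3, (0, 0))%N by rewrite rval_gt0.
apply: computableR_ext (computableR_add (computableR_comp cE c1)
  (computableR_mul t0 ct (computableR_add (computableR_sum cd c2) cg))) => z /=.
rewrite /kl_upper /rval /= !subr0 divr1; congr (_ + _ * (_ + _)).
by rewrite subn1 prednK ?expn_gt0 // natrX.
Qed.

Lemma tilt_test_measure : exists mu : probability cantor R,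
  [/\ mass mu = M, computable_measure mu, full_support mu, ll_kl nu mu &
    computable_reals id (fun n => fine (nu (open_of (s n)))) -> ll_klc nu mu].
Proof.
have [mu muM'] := probability_of_masses (fun t => ltW (M0 t)) M_nil M_rcons.
have muM : mass mu = M by exact/funext.
have cM : computableR (A := str_codeType) M.
  by apply: computableR_tilt => //; [exact: computableR_mass|exact:
    computable_entry].
have supE : kl_sup nu mu = ereal_sup (range (fun n => (E n)%:E)).
  by rewrite kl_sup_level muM.
have sup_ge n : ((E n)%:E <= kl_sup nu mu)%E.
  by rewrite supE; apply: ereal_sup_ubound; exists n.
have sup_le B : (forall n, E n <= B) -> (kl_sup nu mu <= B%:E)%E.
  by move=> EB; rewrite supE; apply: ge_ereal_sup => _ [n _ <-]; rewrite lee_fin.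
have sup_fin : kl_sup nu mu \is a fin_num.
  rewrite fin_numElt (lt_le_trans _ (sup_ge 0)) ?ltNyr //=.
  by rewrite (le_lt_trans (sup_le _ (kl_level_le_upper 0 0))) // ltry.
exists mu; split=> //.
- by rewrite /computable_measure muM; exact: (@computable_reals_of R str_codeType).
- by move=> t; rewrite muM.
move=> su; have cu : computableR u by exact: (@computableR_of R nat_codeType).
pose r := fine (kl_sup nu mu); exists r; first by rewrite fineK.
have rE n : E n <= r by rewrite -lee_fin fineK.
have rB B : (forall n, E n <= B) -> r <= B by move=> /sup_le;
  rewrite -lee_fin fineK.
(* [computable_real] is about a family on [unit] with code 0, obtained here from a constant family
   on [nat] at index 0. *)
suff cr : computableR (fun _ : nat => r).
  have [a [b [c [ra rb rc P]]]] := computable_reals_of cr.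
  by exists a, b, c; split=> // _ n; exact: P 0%N n.
(* The lower cut of [r] is the union of the lower cuts of the levels, its upper cut the union of the
   upper cuts of [kl_upper]. *)
have [loE _] : computableR E.
  by apply: computableR_kl_level => //; exact: computableR_mass.
have [_ hiX] := computableR_kl_upper cu.
split.
- apply: (@sigma1_ext _ (fun z : nat * ratcode => exists n :
  nat, rval R z.2 < E n)).
    case=> a q /=; split=> [[n /lt_le_trans]|qr]; first by apply; exact: rE.
    apply: contrapT => /forallNP nE; move: qr; rewrite ltNge => /negP; apply.
    by apply: rB => n; rewrite leNgt; apply/negP; exact: nE.
  apply: sigma1_exP.
  by apply: (sigma1_comp (f := fun z :
    (nat * ratcode) * nat => (z.2, z.1.2)) loE); computability.
- apply: (@sigma1_ext _ (fun z : nat * ratcode => exists y : nat * nat,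
      kl_upper y.1 y.2 < rval R z.2)).
    case=> a q /=; split=> [[[j n0] /=]|rq].
      by apply: le_lt_trans; apply: rB => n; exact: kl_level_le_upper.
    by have [j [n0 jn]] := kl_upper_lt rE rq; exists (j, n0).
  apply: sigma1_exP.
  by apply: (sigma1_comp (f := fun z :
    (nat * ratcode) * (nat * nat) => (z.2, z.1.2)) hiX);
    computability.
Qed.

End TestTilt.

Lemma block_kl_tilt_diverges (R : realType) (nu : probability cantor R)
    (s : nat -> nat -> seq bool) l w (B0 B1 : R) : full_support nu -> (0 < l)%N ->
  (\bigcap_n open_of (s n)) w ->
  (forall K, \sum_(n < K)
    block_kl (mass nu) (tilt (mass nu) (entry s) false) l (mkseq w n) <= B0) ->
  (forall K, \sum_(n < K)
    block_kl (mass nu) (tilt (mass nu) (entry s) true) l (mkseq w n) <= B1) ->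
      False.
Proof.
move=> fnu l0 ws hB0 hB1.
have N_rcons := @mass_rcons R nu.
pose e n : nat := entry s (mkseq w n).
(* At an entry the two lower bounds p0/4 and p1/4 add up to 1/4, however unbalanced [nu] is there.
   The number of entries along [w] would thus be at most 4 (B0 + B1). *)
have eB K : \sum_(n < K) (e n)%:R / 4 <= B0 + B1.
  apply: le_trans (lerD (hB0 K) (hB1 K)); rewrite -big_split;
    apply: ler_sum => n _ /=.
  set t := mkseq w n.
  have b0 := block_kl1_le fnu (tilt_gt0 (entry s) false fnu) N_rcons
    (tilt_rcons (entry s) false fnu N_rcons) t l0.
  have b1 := block_kl1_le fnu (tilt_gt0 (entry s) true fnu) N_rcons
    (tilt_rcons (entry s) true fnu N_rcons) t l0.
  apply: le_trans (lerD b0 b1); rewrite /e -/t; have [et|net] := boolP (entry s t).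
    have /andP[p0 _] := block_kl_tilt_in false fnu N_rcons et.
    have /andP[p1 _] := block_kl_tilt_in true fnu N_rcons et.
    apply: le_trans (lerD p0 p1); rewrite -!mulrDl -N_rcons divff //.
    exact: lt0r_neq0.
  by rewrite mul0r !block_kl_tilt_out // addr0.
have ex m : exists K, (m <= \sum_(n < K) e n)%N.
  elim: m => [|m [K mK]]; first by exists 0%N.
  have [j Kj ej] := entries_unbounded K ws.
  exists j.+1; rewrite big_ord_recr /= {2}/e ej addn1 ltnS (leq_trans mK) //.
  rewrite -(subnKC (ltnW Kj)) big_split_ord /=; exact: leq_addr.
have [K] := ex (Num.truncn ((B0 + B1) * 4)).+1.
rewrite -(ler_nat R) => h; have := eB K.
rewrite -mulr_suml -natr_sum ler_pdivrMr // => /(le_trans h).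
by rewrite leNgt truncnS_gt.
Qed.

(** The relation is kept abstract so that one argument serves both randomness notions: [ll_kl] with
    any test, [ll_klc] with a test whose measures are computable. *)
Lemma MR1_avoids_tests (R : realType) (nu : probability cantor R)
    (rel : probability cantor R -> probability cantor R -> Prop) l w
    (s : nat -> nat -> seq bool) : computable_measure nu -> full_support nu ->
  (0 < l)%N -> ML_test nu s ->
  (forall mu, ll_kl nu mu ->
     (computable_reals id (fun n => fine (nu (open_of (s n)))) -> ll_klc nu mu) ->
     rel nu mu) ->
  MR1 rel nu l w -> ~ (\bigcap_n open_of (s n)) w.
Proof.
move=> cnu fnu l0 [cs nus] relP wMR ws.
have bnd i : exists B, forall K, \sum_(n < K)
    block_kl (mass nu) (tilt (mass nu) (entry s) i) l (mkseq w n) <= B.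
  have [mu [muM cmu fmu klmu klcmu]] := tilt_test_measure i cnu fnu cs nus.
  have := wMR mu cmu fmu (relP mu klmu klcmu).
  under eq_eseriesr do rewrite KL_F_block //.
  rewrite muM => /nneseries_ltyP; apply => n.
  apply: block_kl_ge0 => //; [by move=> t; rewrite -muM|exact: mass_rcons|].
  by move=> t; rewrite -muM; exact: mass_rcons.
have [B0 hB0] := bnd false; have [B1 hB1] := bnd true.
exact: block_kl_tilt_diverges ws hB0 hB1.
Qed.

Theorem theorem1p12 (R : realType) (nu : probability cantor R)
    (hc : computable_measure nu) (hs : full_support nu)
    (l : nat) (hl : (1 < l)%N) :
  MLR nu = MR1 (@ll_kl R) nu l /\ MR1 (@ll_klc R) nu l `<=` SR nu.
Proof.
have l0 : (0 < l)%N by exact: ltnW.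
split; first (apply/seteqP; split; first exact: MLR_sub_MR1).
  by move=> w wMR s sML; exact: (MR1_avoids_tests hc hs l0 sML _ wMR).
move=> w wMR s [sML su]; apply: (MR1_avoids_tests hc hs l0 sML _ wMR) => mu _.
exact.
Qed.
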